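(* Let $V_1,V_2,V_3$ be two-dimensional vector spaces over $\mathbb{F}_2$. Under the action of the stabiliser group $G_{\mathcal{S}_{1,1,1}(2)}$ of the Segre variety $\mathcal{S}_{1,1,1}(2)$ the points of $\mathbb{P}(V_1\otimes V_2\otimes V_3)=\mathrm{PG}(7,2)$ fall into five orbits $\mathcal{O}_1,\mathcal{O}_2,\ldots,\mathcal{O}_5$. For $r\in\{1,2,3\}$ the points of $\mathcal{O}_r$ are precisely the real points on the lines of $\mathcal{L}_r$. The orbit $\mathcal{O}_4$ comprises those real points on the lines from $\mathcal{L}_4$ which are off the Segre variety $\mathcal{S}_{1,1,1}(2)$, whereas $\mathcal{O}_5$ equals the Segre variety $\mathcal{S}_{1,1,1}(2)$.
   Context: $\mathbb{P}(V)$ is the projective space of one-dimensional subspaces of $V$. The Segre variety is $\mathcal{S}_{1,1,1}(2)=\{\mathbb{F}_2(a_1\otimes a_2\otimes a_3)\mid a_k\in V_k\setminus\{0\}\}\subset\mathbb{P}(V_1\otimes V_2\otimes V_3)$; $G_{\mathcal{S}_{1,1,1}(2)}$ is the group of all elements of $\mathrm{PGL}(V_1\otimes V_2\otimes V_3)$ mapping it onto itself. $\mathbb{F}_4=\{0,1,\omega,\omega^2\}$ with $\omega^2+\omega+1=0$, $W_k=\mathbb{F}_4\otimes_{\mathbb{F}_2}V_k\supset V_k$ (via $a\mapsto 1\otimes a$), and $\mathbb{F}_4\otimes_{\mathbb{F}_2}(V_1\otimes V_2\otimes V_3)$ is identified with $W_1\otimes W_2\otimes W_3$, so $\mathrm{PG}(7,2)=\mathbb{P}(V_1\otimes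 V_2\otimes V_3)\subset\mathbb{P}(W_1\otimes W_2\otimes W_3)=\mathrm{PG}(7,4)$. Points of $\mathrm{PG}(7,2)$ are called real; a line of $\mathrm{PG}(7,4)$ is real if it is spanned by a line of $\mathrm{PG}(7,2)$, and lines of $\mathrm{PG}(7,2)$ are identified with the real lines they span. For each $k$ fix a basis $(e_0^{(k)},e_1^{(k)})$ of $V_k$ and put $u_0^{(k)}=e_0^{(k)}+\omega e_1^{(k)}$, $u_1^{(k)}=e_0^{(k)}+\omega^2e_1^{(k)}$, and $U_{i_1i_2i_3}=u_{i_1}^{(1)}\otimes u_{i_2}^{(2)}\otimes u_{i_3}^{(3)}$ for $(i_1,i_2,i_3)\in\{0,1\}^3$. Put $\mathcal{B}_3^+=\{\mathbb{F}_4U_{000},\mathbb{F}_4U_{011},\mathbb{F}_4U_{101},\mathbb{F}_4U_{110}\}$, whose $\mathbb{F}_4$-span is $\mathrm{span}\,\mathcal{B}_3^+=\mathrm{PG}(3,4)$. The planes of the tetrahedron $\mathcal{B}_3^+$ are the four planes spanned by three of the four points of $\mathcal{B}_3^+$. The invariant spread $\mathcal{L}$ is the set of all real lines meeting $\mathrm{span}\,\mathcal{B}_3^+$; each point of $\mathrm{PG}(7,2)$ lies on exactly one of its lines, and each of its lines meets $\mathrm{span}\,\mathcal{B}_3^+$ in exactly one point. For $r\in\{1,2,3,4\}$, $\mathcal{L}_r$ is the set of those lines of $\mathcal{L}$ whose point of intersection with $\mathrm{span}\,\mathcal{B}_3^+$ lies in exactly $4-r$ planes of the tetrahedron $\mathcal{B}_3^+$.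 *)

(* Defs.v *)
From HB Require Import structures.
From mathcomp Require Import all_boot all_order all_algebra all_field.
From mathcomp Require Import boolp classical_sets.

Set Implicit Arguments.
Unset Strict Implicit.
Unset Printing Implicit Defensive.

Import GRing.Theory.
Local Open Scope classical_set_scope.
Local Open Scope ring_scope.

Definition trilinear (F : fieldType) (V1 V2 V3 X : lmodType F)
    (f : V1 -> V2 -> V3 -> X) : Prop :=
  [/\ forall b c, linear (fun a => f a b c),
      forall a c, linear (fun b => f a b c)
    & forall a b, linear (fun c => f a b c)].

(* (T, tau) is a tensor product of V1, V2, V3 over F, with
   a (x) b (x) c = tau a b c: universal property among all F-modules. *)
Definition is_tensor_product (F : fieldType) (V1 V2 V3 T : lmodType F)
    (tau : V1 -> V2 -> V3 -> T) : Prop :=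
  trilinear tau /\
  forall (X : lmodType F) (f : V1 -> V2 -> V3 -> X), trilinear f ->
    exists g : T -> X,
      [/\ linear g,
          forall a b c, g (tau a b c) = f a b c
        & forall h : T -> X, linear h ->
            (forall a b c, h (tau a b c) = f a b c) -> h =1 g].

(* F-linearity of a map from an F-module to a K-module, K an extension of F. *)
Definition base_linear (F : fieldType) (K : fieldExtType F) (V : lmodType F)
    (X : lmodType K) (f : V -> X) : Prop :=
  linear_for (in_alg K \; *:%R) f.

(* (W, j) is K (x)_F V, with j v = 1 (x) v: universal property. *)
Definition is_scalar_extension (F : fieldType) (K : fieldExtType F)
    (V : lmodType F) (W : lmodType K) (j : V -> W) : Prop :=
  base_linear j /\
  forall (X : lmodType K) (f : V -> X), base_linear f ->
    exists g : W -> X,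
      [/\ linear g,
          forall v, g (j v) = f v
        & forall h : W -> X, linear h -> (forall v, h (j v) = f v) -> h =1 g].

(* j : T -> W is the inclusion of T in K (x)_F T when the latter is identified
   with the tensor product (W, tauW) of the spaces K (x)_F V_k, (W_k, j_k).
   It is determined by these conditions, pure tensors generating T. *)
Definition is_real_inclusion (F : fieldType) (K : fieldExtType F)
    (V1 V2 V3 T : lmodType F) (tau : V1 -> V2 -> V3 -> T)
    (W1 W2 W3 W : lmodType K) (tauW : W1 -> W2 -> W3 -> W)
    (j1 : V1 -> W1) (j2 : V2 -> W2) (j3 : V3 -> W3) (j : T -> W) : Prop :=
  base_linear j /\
  forall a b c, j (tau a b c) = tauW (j1 a) (j2 b) (j3 c).

Definition points (F : fieldType) (V : vectType F) : set {vspace V} :=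
  [set P | \dim P = 1%N].

Definition lines (F : fieldType) (V : vectType F) : set {vspace V} :=
  [set L | \dim L = 2%N].

(* An element of PGL(V) is the class of an invertible f modulo nonzero scalars,
   which is represented by the induced map on subspaces. *)
Definition PGL (F : fieldType) (V : vectType F) :
    set ({vspace V} -> {vspace V}) :=
  [set g | exists2 f : 'End(V), lker f = 0%VS & g = (fun P => f @: P)%VS].

Definition stabiliser (F : fieldType) (V : vectType F) (S : set {vspace V}) :
    set ({vspace V} -> {vspace V}) :=
  [set g | PGL g /\ g @` S = S].

Definition point_orbits (F : fieldType) (V : vectType F)
    (G : set ({vspace V} -> {vspace V})) : set (set {vspace V}) :=
  [set [set g P | g in G] | P in @points F V].

Definition Segre (F : fieldType) (V1 V2 V3 T : vectType F)
    (tau : V1 -> V2 -> V3 -> T) : set {vspace T} :=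
  [set P | exists a b c,
     [/\ a != 0, b != 0, c != 0 & P = <[tau a b c]>%VS]].

(* The K-span of j(P), which does not depend on the basis of P if j is
   F-linear. *)
Definition extend (F : fieldType) (K : fieldExtType F) (T : vectType F)
    (W : vectType K) (j : T -> W) (P : {vspace T}) : {vspace W} :=
  <<[seq j x | x <- vbasis P]>>%VS.

Definition real_lines (F : fieldType) (K : fieldExtType F) (T : vectType F)
    (W : vectType K) (j : T -> W) : set {vspace W} :=
  [set extend j l | l in @lines F T].

Definition real_points_on (F : fieldType) (K : fieldExtType F) (T : vectType F)
    (W : vectType K) (j : T -> W) (Ls : set {vspace W}) : set {vspace T} :=
  [set P | points P /\ exists2 M, Ls M & (extend j P <= M)%VS].

(* u_0 = e_0 + omega e_1 and u_1 = e_0 + omega^2 e_1 *)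
Definition uvec (F : fieldType) (K : fieldExtType F) (omega : K)
    (V : vectType F) (W : vectType K) (j : V -> W) (e : 'I_2 -> V)
    (i : 'I_2) : W :=
  j (e 0) + omega ^+ i.+1 *: j (e 1).

(* The vertices of the tetrahedron B_3^+, as points of P(W). *)
Definition Bplus (K : fieldType) (W1 W2 W3 W : vectType K)
    (tauW : W1 -> W2 -> W3 -> W)
    (u1 : 'I_2 -> W1) (u2 : 'I_2 -> W2) (u3 : 'I_2 -> W3) :
    4.-tuple {vspace W} :=
  let U i1 i2 i3 := tauW (u1 i1) (u2 i2) (u3 i3) in
  map_tuple (@vline K W) [tuple U 0 0 0; U 0 1 1; U 1 0 1; U 1 1 0].

Definition tspan (K : fieldType) (W : vectType K) (B : 4.-tuple {vspace W}) :
    {vspace W} :=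
  (\sum_(i < 4) tnth B i)%VS.

(* The plane of the tetrahedron B opposite to its i-th vertex. *)
Definition tplane (K : fieldType) (W : vectType K) (B : 4.-tuple {vspace W})
    (i : 'I_4) : {vspace W} :=
  (\sum_(k < 4 | k != i) tnth B k)%VS.

Definition spread (F : fieldType) (K : fieldExtType F) (T : vectType F)
    (W : vectType K) (j : T -> W) (B : 4.-tuple {vspace W}) :
    set {vspace W} :=
  [set M | real_lines j M /\
     exists2 X, points X & (X <= M :&: tspan B)%VS].

Definition spread_class (F : fieldType) (K : fieldExtType F) (T : vectType F)
    (W : vectType K) (j : T -> W) (B : 4.-tuple {vspace W}) (r : nat) :
    set {vspace W} :=
  [set M | spread j B M /\
     exists X, [/\ points X, (M :&: tspan B)%VS = X
                 & #|[pred i | (X <= tplane B i)%VS]| = (4 - r)%N]].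

(* Main.v *)
Require Import Defs.
From HB Require Import structures.
From mathcomp Require Import all_boot all_order all_algebra all_field.
From mathcomp Require Import fingroup perm.
From mathcomp Require Import boolp classical_sets.
From mathcomp Require Import ring.
Set Implicit Arguments.
Unset Strict Implicit.
Unset Printing Implicit Defensive.
Import GRing.Theory.
Local Open Scope classical_set_scope.
Local Open Scope ring_scope.

(** Write V_k as the field F_4 itself: the coordinate of 1 (x) v on u_0 is an
F_2-linear bijection lambda_k : V_k -> F_4, and the coordinate on u_1 is its
conjugate, that is, its square. Taking the coordinates of 1 (x) t on the four
vertices of the tetrahedron gives an F_2-linear bijection phi from the tensor
space onto F_4^4, with

  phi (a (x) b (x) c) = (x y z, x y^2 z^2, x^2 y z^2, x^2 y^2 z)

for x = lambda_1 a, y = lambda_2 b, z = lambda_3 c. The remaining four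
coordinates of 1 (x) t are the squares of those of phi t.

Two facts turn the theorem into a statement about F_4^4. The product of the four
coordinates above is (x y z)^6, which is 1 when a, b, c are nonzero, and every
vector of F_4^4 whose coordinates have product 1 is of this form
([unit_tensor]): so phi maps the Segre variety onto the set S of the vectors with
coordinate product 1 ([Segre_vline]). And the spread line through a real point
<x> is the span of 1 (x) x and 1 (x) y with phi y = omega phi x; it meets the span
of the tetrahedron in the point with coordinates phi x. Hence the real points on
the lines of the r-th class are those for which phi x has r nonzero entries
([real_points_spread_class]).

It remains to find the orbits, on the nonzero vectors of F_4^4, of the group of
F_2-linear bijections that preserve S ([conjugateP]). Coordinate permutations,
diagonal matrices of determinant 1 and the Frobenius map belong to it, and they
already carry each vector to one of five representatives
([conjugate_representative]): Hamming weight 1, 2, 3, weight 4 outside S, and S.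
No other element of the group merges two of these sets, because they are told
apart by the lines that join a vector to elements of S
([stratum_secant_type]): outside S, a vector of weight 2 is in several ways the sum of
two elements of S, a vector of weight 3 in exactly one way, and the others in
none; a vector of weight 4 is the sum of an element of S and a vector of weight 2,
a vector of weight 1 is not. The impossibilities rest on one identity: if s and
y + s lie in S, then replacing each zero entry of y by the corresponding entry of
s gives an element of S ([secant_prod]). *)

(** * Linear algebra over the field with two elements *)

Lemma span2P (F : fieldType) (V : vectType F) (u v z : V) :
  reflect (exists a b, z = a *: u + b *: v) (z \in span [:: u; v]).
Proof.
rewrite span_cons span_seq1; apply: (iffP memv_addP).
  case=> _ /vlineP[a ->] [_ /vlineP[b ->] ->].
  by exists a, b.
case=> a [b ->]; exists (a *: u); rewrite ?memvZ ?memv_line //.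
by exists (b *: v); rewrite ?memvZ ?memv_line.
Qed.

Lemma F2P (k : 'F_2) : k = 0 \/ k = 1.
Proof. by case: k => -[|[|//]] i; [left|right]; apply/val_inj. Qed.

Lemma addvv2 (V : lmodType 'F_2) (x : V) : x + x = 0.
Proof. by rewrite -mulr2n -scaler_nat (_ : 2%:R = 0) ?scale0r //; apply/val_inj. Qed.

Lemma oppv2 (V : lmodType 'F_2) (x : V) : - x = x.
Proof. by apply/eqP; rewrite eq_sym -addr_eq0 addvv2. Qed.

Lemma additive_linear2 (U V : lmodType 'F_2) (f : U -> V) :
  {morph f : x y / x + y} -> linear f.
Proof.
move=> fD k x y; rewrite fD; congr (_ + _); case: (F2P k) => ->; last by rewrite !scale1r.
by rewrite !scale0r -[in LHS](addvv2 0) fD addvv2.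
Qed.

(** * The field of order four *)

Section FieldOfOrderFour.

Variables (F4 : fieldExtType 'F_2) (w : F4).
Hypotheses (dimF4 : \dim {:F4} = 2%N) (Hw : w ^+ 2 + w + 1 = 0).

Lemma omega_neq0 : w != 0.
Proof.
apply/eqP=> w0; move: Hw; rewrite w0 expr0n !add0r => /eqP.
by rewrite oner_eq0.
Qed.

Lemma addr1_omega : 1 + w = w ^+ 2.
Proof. by apply/esym/eqP; rewrite -[1 + w]oppv2 -addr_eq0 (addrC 1) addrA Hw. Qed.

Lemma omega_cube : w ^+ 3 = 1.
Proof. by rewrite exprS -addr1_omega mulrDr mulr1 -expr2 -addr1_omega addrCA addvv2 addr0. Qed.

Lemma addr_omega_sqr : w + w ^+ 2 = 1.
Proof. by rewrite -addr1_omega addrCA addvv2 addr0. Qed.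

Lemma addr1_omega_sqr : 1 + w ^+ 2 = w.
Proof. by rewrite -addr1_omega addrA addvv2 add0r. Qed.

Lemma omega_neq1 : w != 1.
Proof.
apply/eqP => w1; move: addr1_omega; rewrite w1 addvv2 expr1n => /eqP.
by rewrite eq_sym oner_eq0.
Qed.

Lemma omega_sqr_neq1 : w ^+ 2 != 1.
Proof.
rewrite -subr_eq0 subr_sqr_1 mulf_neq0 // ?subr_eq0 ?omega_neq1 //.
by rewrite addrC addr1_omega expf_neq0 // omega_neq0.
Qed.

Lemma F4_coordinates (x : F4) : exists a b : 'F_2, x = a%:A + b *: w.
Proof.
have fr : free [:: 1; w].
  rewrite free_cons span_seq1 seq1_free omega_neq0 ?andbT; apply/vlineP => -[k].
  by case: (F2P k) => -> /eqP; rewrite ?scale0r ?scale1r ?oner_eq0 // eq_sym (negbTE omega_neq1).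
have : x \in span [:: 1; w].
  suff -> : span [:: 1; w] = fullv by rewrite memvf.
  apply/eqP; rewrite eqEdim subvf dimF4 (_ : \dim _ = 2%N) //.
  by apply/eqP; rewrite -[_ == _]/(free [:: 1; w]).
by case/span2P => a [b ->]; exists a, b.
Qed.

Lemma F4P (x : F4) : [\/ x = 0, x = 1, x = w | x = w ^+ 2].
Proof.
have [a [b ->]] := F4_coordinates x.
case: (F2P a) => ->; case: (F2P b) => ->;
  rewrite ?scale0r ?scale1r ?addr0 ?add0r ?addr1_omega;
  [exact: Or41|exact: Or43|exact: Or42|exact: Or44].
Qed.

Lemma F4_cube (x : F4) : x != 0 -> x ^+ 3 = 1.
Proof.
case: (F4P x) => -> //; rewrite ?eqxx ?expr1n ?omega_cube //.
by rewrite -exprM mulnC exprM omega_cube expr1n.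
Qed.

Lemma F4_expr4 (x : F4) : x ^+ 4 = x.
Proof.
have [->|x0] := eqVneq x 0; first by rewrite expr0n.
by rewrite exprS F4_cube // mulr1.
Qed.

Lemma F4_sqrD : {morph (fun x : F4 => x ^+ 2) : x y / x + y}.
Proof. by move=> x y; rewrite /= sqrrD mulr2n addvv2 addr0. Qed.

Lemma F4_sqr_inj : injective (fun x : F4 => x ^+ 2).
Proof. by move=> x y /(congr1 (fun z => z ^+ 2)) /=; rewrite -!exprM !F4_expr4. Qed.

(** In the additive Klein group of [F4], [a], [b] and [a + b] are the three nonzero
elements, and these have product [1 = a ^+ 3]. *)
Lemma F4_mul_others (a b : F4) :
  a != 0 -> b != 0 -> a + b != 0 -> b * (a + b) = a ^+ 2.
Proof.
move=> a0 b0 ab0; apply/eqP; rewrite -[a ^+ 2]oppv2 -addr_eq0.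
apply/eqP/(mulfI ab0); rewrite mulr0 -{1}[b]oppv2.
transitivity (a ^+ 3 - b ^+ 3); first by ring.
by rewrite !F4_cube // subrr.
Qed.

End FieldOfOrderFour.

(** * Four coordinates: vectors of product one and their symmetries *)

Section Model.

Variables (F4 : fieldExtType 'F_2) (w : F4).
Hypotheses (dimF4 : \dim {:F4} = 2%N) (Hw : w ^+ 2 + w + 1 = 0).

Let w_neq0 := omega_neq0 Hw.
Let w2_neq0 : w ^+ 2 != 0. Proof. exact: expf_neq0. Qed.

Local Notation X := {ffun 'I_4 -> F4}.
Implicit Types (y s t : X).

Definition unit_prod y := \prod_i y i == 1.

(** Hamming weight. *)
Definition weight y := #|[pred i | y i != 0]|.

Definition stratum y : nat := if unit_prod y then 5%N else weight y.

Definition symmetry (h : X -> X) :=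
  [/\ linear h, bijective h & forall y, unit_prod (h y) = unit_prod y].

Definition conjugate y y' := exists2 h, symmetry h & h y = y'.

Lemma symmetry_inv h : symmetry h -> exists2 h', symmetry h' & cancel h h'.
Proof.
case=> hL [h' hK h'K] hS; exists h' => //; split; last by move=> y; rewrite -hS h'K.
  by move=> k u v; apply: (can_inj hK); rewrite hL !h'K.
by exists h.
Qed.

Lemma symmetry_comp h h' : symmetry h -> symmetry h' -> symmetry (h \o h').
Proof.
case=> hL hB hS [h'L h'B h'S]; split; last by move=> y; rewrite /= hS h'S.
  by move=> k u v; rewrite /= h'L hL.
exact: bij_comp.
Qed.

Lemma conjugate_sym y y' : conjugate y y' -> conjugate y' y.
Proof.
by case=> h /symmetry_inv[h' h'S hK] <-; exists h'.
Qed.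

Lemma conjugate_trans y y' y'' : conjugate y y' -> conjugate y' y'' -> conjugate y y''.
Proof.
by case=> h hS <- [h' h'S <-]; exists (h' \o h) => //; apply: symmetry_comp.
Qed.

Lemma unit_prod_neq0 y i : unit_prod y -> y i != 0.
Proof.
move=> /eqP y1; apply: contra_eq_neq y1 => yi0.
by rewrite (bigD1 i) //= yi0 mul0r eq_sym oner_neq0.
Qed.

Lemma unit_prod_weight y : unit_prod y -> weight y = 4%N.
Proof.
move=> y1; rewrite -[RHS](card_ord 4).
by apply: eq_card => i; rewrite !inE unit_prod_neq0.
Qed.

Lemma weight4_neq0 y i : weight y = 4%N -> y i != 0.
Proof.
move=> y4; have := subset_cardP (etrans y4 (esym (card_ord 4))) (subset_predT _) i.
by rewrite !inE.
Qed.

Lemma weight_gt0 y : (0 < weight y)%N = (y != 0).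
Proof.
rewrite lt0n; congr (~~ _); apply/pred0P/eqP => [y0|-> i]; last by rewrite /= ffunE eqxx.
by apply/ffunP => i; rewrite ffunE; apply/eqP/negPn; have /= -> := y0 i.
Qed.

Lemma weight_le4 y : (weight y <= 4)%N.
Proof. by rewrite (leq_trans (max_card _)) ?card_ord. Qed.

Lemma stratum_bounds y : y != 0 -> (0 < stratum y <= 5)%N.
Proof.
by rewrite /stratum -weight_gt0; case: ifP => // _ ->; rewrite (leq_trans (weight_le4 y)).
Qed.

Lemma stratum_eq5 y : (stratum y == 5%N) = unit_prod y.
Proof.
rewrite /stratum; case: ifP => // _; apply/eqP => y5.
by have := weight_le4 y; rewrite y5.
Qed.

Lemma diagonal_symmetry (d : X) : unit_prod d -> symmetry (fun y => [ffun i => d i * y i]).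
Proof.
move=> d1; split=> [k u v||y].
- by apply/ffunP=> i; rewrite !ffunE mulrDr scalerAr.
- exists (fun y => [ffun i => (d i)^-1 * y i]) => y; apply/ffunP=> i; rewrite !ffunE.
    by rewrite mulKf // unit_prod_neq0.
  by rewrite mulVKf // unit_prod_neq0.
rewrite /unit_prod (eq_bigr (fun i => d i * y i)) => [|i _]; last by rewrite ffunE.
by rewrite big_split /= (eqP d1) mul1r.
Qed.

Lemma permutation_symmetry (p : 'S_4) : symmetry (fun y => [ffun i => y (p i)]).
Proof.
split=> [k u v||y].
- by apply/ffunP=> i; rewrite !ffunE.
- exists (fun y => [ffun i => y ((p^-1)%g i)]) => y; apply/ffunP=> i; rewrite !ffunE.
    by rewrite permKV.
  by rewrite permK.
rewrite /unit_prod [in RHS](reindex_inj (@perm_inj _ p)) /=.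
by under eq_bigr do rewrite ffunE.
Qed.

Lemma frobenius_symmetry : symmetry (fun y => [ffun i => y i ^+ 2]).
Proof.
split=> [||y].
- by apply: additive_linear2 => u v; apply/ffunP=> i; rewrite !ffunE F4_sqrD.
- by exists (fun y => [ffun i => y i ^+ 2]) => y; apply/ffunP=> i;
    rewrite !ffunE -exprM (F4_expr4 dimF4 Hw).
rewrite /unit_prod (eq_bigr (fun i => y i ^+ 2)) => [|i _]; last by rewrite ffunE.
by rewrite prodrXl -[X in _ == X](expr1n _ 2) (inj_eq (F4_sqr_inj dimF4 Hw)).
Qed.

(** Diagonal matrices of determinant 1 act transitively on the vectors with a given
support, if it is not full; on a full support, the product is the
only invariant. *)
Lemma conjugate_scaling y y' : (forall i, (y i == 0) = (y' i == 0)) ->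
  (exists i, y i = 0) \/ \prod_i y i = \prod_i y' i -> conjugate y y'.
Proof.
move=> supp H.
suff [d d1 dE] : exists2 d, unit_prod d & forall i, d i * y i = y' i.
  by exists (fun y => [ffun i => d i * y i]);
    [exact: diagonal_symmetry | apply/ffunP=> i; rewrite ffunE].
pose z : X := [ffun i => if y i == 0 then 1 else y' i / y i].
have zE i : z i * y i = y' i.
  rewrite ffunE; case: ifPn => [|yi0]; last by rewrite divfK.
  by move=> yi0; have := supp i; rewrite yi0 (eqP yi0) mulr0 => /esym/eqP ->.
have z0 i : z i != 0.
  rewrite ffunE; case: ifPn => yi0; rewrite ?oner_neq0 // mulf_neq0 //.
    by rewrite -supp.
  by rewrite invr_neq0.
have P0 : \prod_i z i != 0 by apply/prodf_neq0.
case: (pselect (exists i, y i = 0)) => [[k yk0]|none]; last first.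
  case: H => [/none[]|H]; exists z => //.
  have Py0 : \prod_i y i != 0.
    by apply/prodf_neq0 => i _; apply/eqP => yi0; apply: none; exists i.
  rewrite /unit_prod; apply/eqP/(mulIf Py0).
  by rewrite mul1r -big_split H; apply: eq_bigr => i _; apply: zE.
(* The diagonal matrix [z] is corrected to determinant 1 at a place where its entry
   has no effect. *)
exists [ffun i => z i * (if i == k then (\prod_i z i)^-1 else 1)] => [|i].
  rewrite /unit_prod; under eq_bigr do rewrite ffunE.
  by rewrite big_split /= -big_mkcond big_pred1_eq mulfV.
rewrite ffunE; case: eqP => [->|_]; last by rewrite mulr1.
by rewrite yk0 mulr0 -(zE k) yk0 mulr0.
Qed.

(** For [r = 4] the entry [w] keeps the product different from 1. *)
Definition representative (r : nat) : X :=
  [ffun i : 'I_4 => if (r == 4%N) && (i == 0) then w else (i < r)%N%:R].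

(** Two boolean sequences with equally many [true] are permutations of each other. *)
Lemma sorted_support y : exists p : 'S_4, forall i, (y (p i) != 0) = (i < weight y)%N.
Proof.
pose t := [tuple y i != 0 | i < 4].
pose s := [tuple (i < weight y)%N | i < 4].
have ct : count id t = weight y.
  by rewrite count_map -size_filter /weight cardE /enum_mem -enumT.
have cs : count id s = weight y.
  have -> : tval s = [seq (k < weight y)%N | k <- iota 0 4].
    by rewrite -val_enum_ord -map_comp.
  rewrite count_map; have := weight_le4 y.
  by case: (weight y) => [|[|[|[|[]]]]].
have /tuple_permP[p sE] : perm_eq s t.
  apply/allP => b _; apply/eqP.
  have E (u : 4.-tuple bool) : count_mem false u = (4 - count id u)%N.
    have := congr1 (subn^~ (count id u)) (count_predC id u).
    by rewrite /= addKn size_tuple => <-; apply: eq_count => -[].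
  case: b; last by rewrite !E ct cs.
  by rewrite -[RHS](@eq_count _ id) 1?[LHS](@eq_count _ _ id) ?ct // => -[].
exists p => i; have := congr1 (fun u => nth false u i) sE.
by rewrite -!tnth_nth !tnth_mktuple.
Qed.

Definition vec (a b c d : F4) : X := [ffun i : 'I_4 => [:: a; b; c; d]`_i].

Lemma vecP y : exists a b c d, y = vec a b c d.
Proof.
exists (y (inord 0)), (y (inord 1)), (y (inord 2)), (y (inord 3)).
by apply/ffunP => -[[|[|[|[|//]]]] i]; rewrite ffunE /=; congr (y _);
  apply/val_inj; rewrite /= inordK.
Qed.

Lemma vecD a b c d a' b' c' d' :
  vec a b c d + vec a' b' c' d' = vec (a + a') (b + b') (c + c') (d + d').
Proof. by apply/ffunP => -[[|[|[|[|//]]]] i]; rewrite !ffunE. Qed.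

Lemma vec_inj a b c d a' b' c' d' :
  vec a b c d = vec a' b' c' d' -> [/\ a = a', b = b', c = c' & d = d'].
Proof.
move=> e; have E k : vec a b c d (inord k) = vec a' b' c' d' (inord k) by rewrite e.
by have := (E 0%N, E 1%N, E 2%N, E 3%N); rewrite !ffunE !inordK //= => -[[[]]].
Qed.

Lemma unit_prod_vec a b c d : unit_prod (vec a b c d) = (a * b * c * d == 1).
Proof.
rewrite /unit_prod; congr (_ == _).
by rewrite !big_ord_recl big_ord0 !ffunE /= mulr1 !mulrA.
Qed.

Lemma weight_vec a b c d :
  weight (vec a b c d) = ((a != 0)%R + (b != 0)%R + (c != 0)%R + (d != 0)%R)%N.
Proof.
rewrite /weight -sum1_card big_mkcond /= !big_ord_recl big_ord0 !inE !ffunE /= addn0 !addnA.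
by do !case: (_ == _).
Qed.

Lemma representative1 : representative 1 = vec 1 0 0 0.
Proof. by apply/ffunP => -[[|[|[|[|//]]]] i]; rewrite !ffunE. Qed.

Lemma representative2 : representative 2 = vec 1 1 0 0.
Proof. by apply/ffunP => -[[|[|[|[|//]]]] i]; rewrite !ffunE. Qed.

Lemma representative3 : representative 3 = vec 1 1 1 0.
Proof. by apply/ffunP => -[[|[|[|[|//]]]] i]; rewrite !ffunE. Qed.

Lemma representative4 : representative 4 = vec w 1 1 1.
Proof. by apply/ffunP => -[[|[|[|[|//]]]] i]; rewrite !ffunE. Qed.

Lemma representative5 : representative 5 = vec 1 1 1 1.
Proof. by apply/ffunP => -[[|[|[|[|//]]]] i]; rewrite !ffunE. Qed.

Definition representativeE := (representative1, representative2, representative3,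
  representative4, representative5).

Lemma stratum_representative r : (0 < r <= 5)%N -> stratum (representative r) = r.
Proof.
case: r => [|[|[|[|[|[|[]]]]]]] // _;
  rewrite representativeE /stratum unit_prod_vec weight_vec ?oner_neq0 ?eqxx ?w_neq0
    ?mulr1 ?mulr0 ?eqxx //= ?(negbTE (omega_neq1 Hw)) // eq_sym oner_eq0 //.
Qed.

(** Every weight below 4 leaves room to absorb the determinant of a diagonal matrix.
For full support the product is 1, [w] or [w ^+ 2], and the Frobenius map exchanges
the last two. *)
Lemma conjugate_representative y : y != 0 -> conjugate y (representative (stratum y)).
Proof.
move=> y0; rewrite /stratum; case: ifPn => [y1|yn1].
  apply: conjugate_scaling => [i|].
    rewrite (negbTE (unit_prod_neq0 i y1)) representative5; apply/esym/negbTE.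
    by rewrite unit_prod_neq0 // unit_prod_vec !mulr1.
  right; rewrite (eqP y1) representative5; apply/esym/eqP.
  by rewrite -[_ == _]/(unit_prod _) unit_prod_vec !mulr1.
have [y4|yn4] := eqVneq (weight y) 4%N; last first.
  have [p pE] := sorted_support y.
  apply: (@conjugate_trans _ [ffun i => y (p i)]).
    by exists (fun y : X => [ffun i => y (p i)]) => //; apply: permutation_symmetry.
  have lt4 : (weight y < 4)%N by rewrite ltn_neqAle yn4 weight_le4.
  apply: conjugate_scaling => [i|].
    rewrite !ffunE (negbTE yn4) /=; have := pE i; case: (_ < _)%N => [/negbTE ->|/negbFE ->].
      by rewrite oner_eq0.
    by rewrite eqxx.
  left; exists ord_max; rewrite ffunE; apply/eqP/negbFE.
  by rewrite pE /= leqNgt lt4.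
have key y' : weight y' = 4%N -> \prod_i y' i = w -> conjugate y' (representative 4).
  move=> y'4 y'w; apply: conjugate_scaling => [i|].
    rewrite (negbTE (weight4_neq0 i y'4)); apply/esym/negbTE/weight4_neq0.
    by rewrite representative4 weight_vec w_neq0 oner_neq0.
  right; rewrite y'w representative4 !big_ord_recl big_ord0 !ffunE /=.
  by rewrite !mulr1.
rewrite y4; case: (F4P dimF4 Hw (\prod_i y i)) => P.
- have : \prod_i y i != 0 by apply/prodf_neq0 => i _; apply: weight4_neq0.
  by rewrite P eqxx.
- by case/eqP: yn1.
- exact: key.
apply: (@conjugate_trans _ [ffun i => y i ^+ 2]).
  by exists (fun y : X => [ffun i => y i ^+ 2]) => //; apply: frobenius_symmetry.
apply: key.
  by rewrite -[RHS]y4; apply: eq_card => i; rewrite !inE ffunE expf_eq0.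
under eq_bigr do rewrite ffunE.
by rewrite prodrXl P -exprM (F4_expr4 dimF4 Hw).
Qed.

(** * Secants separate the strata *)

(** The third point of the line through [y] and [s] is [y + s]. *)
Definition secant y s := unit_prod s && unit_prod (y + s).

(** The pairs [{s, y + s}] and [{t, y + t}] are different. *)
Definition two_secants y :=
  exists s t, [/\ secant y s, secant y t, t != s & t != y + s].

Definition joined y :=
  exists2 s, unit_prod s & ~~ unit_prod (y + s) /\ two_secants (y + s).

(** An expression of the stratum in terms of the additive structure and of the set of
vectors of product one alone; invariance under symmetries is thus immediate. *)
Definition secant_type y : nat :=
  if unit_prod y then 5%N else
  if `[< two_secants y >] then 2%N else
  if `[< exists s, secant y s >] then 3%N else
  if `[< joined y >] then 4%N else 1%N.

Section Invariance.

Variables (h : X -> X) (hS : symmetry h).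

Let hD : {morph h : y s / y + s}.
Proof. by case: hS => hL _ _ y s; rewrite -[y]scale1r hL !scale1r. Qed.
Let hinj : injective h. Proof. by case: hS => _ /bij_inj. Qed.
Let hU y : unit_prod (h y) = unit_prod y. Proof. by case: hS. Qed.

Lemma secant_symmetry y s : secant (h y) (h s) = secant y s.
Proof. by rewrite /secant -hD !hU. Qed.

Lemma two_secants_symmetry y : two_secants y -> two_secants (h y).
Proof.
case=> s [t [ys yt ts tys]]; exists (h s), (h t).
by rewrite !secant_symmetry -hD !(inj_eq hinj).
Qed.

Lemma joined_symmetry y : joined y -> joined (h y).
Proof.
case=> s s1 [ys1 yt]; exists (h s); rewrite ?hU // -hD hU; split=> //.
exact: two_secants_symmetry.
Qed.

End Invariance.

Lemma secant_type_symmetry h y : symmetry h -> secant_type (h y) = secant_type y.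
Proof.
move=> hS; have [h' h'S hK] := symmetry_inv hS.
have many : `[< two_secants (h y) >] = `[< two_secants y >].
  apply/asboolP/asboolP; last exact: two_secants_symmetry.
  by move=> /(two_secants_symmetry h'S); rewrite hK.
have one : `[< exists s, secant (h y) s >] = `[< exists s, secant y s >].
  apply/asboolP/asboolP => -[s ys].
    by exists (h' s); rewrite -[y]hK secant_symmetry.
  by exists (h s); rewrite secant_symmetry.
have join : `[< joined (h y) >] = `[< joined y >].
  apply/asboolP/asboolP; last exact: joined_symmetry.
  by move=> /(joined_symmetry h'S); rewrite hK.
by rewrite /secant_type many one join; case: (hS) => _ _ ->.
Qed.

(** For [y i != 0] both [s i] and [y i + s i] are nonzero, hence their product is
[y i ^+ 2]; for [y i = 0] it is [s i ^+ 2]. So the square of the product is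
[1 * 1], and squaring is injective. *)
Lemma secant_prod y s :
  secant y s -> \prod_i (if y i == 0 then s i else y i) = 1.
Proof.
case/andP => s1 ys1; apply: (F4_sqr_inj dimF4 Hw); rewrite expr1n.
transitivity ((\prod_i s i) * (\prod_i (y + s) i)); last first.
  by rewrite (eqP s1) (eqP ys1) mulr1.
rewrite -big_split -prodrXl; apply: eq_bigr => i _ /=; rewrite ffunE.
have := unit_prod_neq0 i s1; have := unit_prod_neq0 i ys1; rewrite ffunE.
case: (y i =P 0) => [->|/eqP]; first by rewrite add0r expr2.
by move: (y i) (s i) => a b a0 ab0 b0; rewrite (F4_mul_others dimF4 Hw).
Qed.


Let w3 := omega_cube Hw.
Let w4 : w ^+ 4 = w. Proof. by rewrite exprS w3 mulr1. Qed.

Lemma two_secants_representative2 : two_secants (representative 2).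
Proof.
rewrite representative2; exists (vec w (w ^+ 2) 1 1), (vec w (w ^+ 2) w (w ^+ 2)).
have E : w ^+ 2 * w = 1 by rewrite -exprSr.
split; rewrite /secant ?vecD ?(addr1_omega Hw) ?(addr1_omega_sqr Hw) ?add0r ?addr0
  ?unit_prod_vec ?mulr1 -?exprS ?w3 ?E ?mul1r -?exprS ?w3 ?eqxx //.
  by apply/eqP => /vec_inj[_ _ /eqP]; rewrite (negbTE (omega_neq1 Hw)).
apply/eqP => /vec_inj[/eqP].
by rewrite -[w in w == _]mulr1 expr2 (inj_eq (mulfI w_neq0)) eq_sym (negbTE (omega_neq1 Hw)).
Qed.

(** By [secant_prod] the first entry of [s] would be that of [y], so that [y + s] would
have a zero entry. *)
Lemma secant_representative1 s : ~~ secant (representative 1) s.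
Proof.
apply/negP => ys; have := secant_prod ys; case/andP: ys.
have [a [b [c [d ->]]]] := vecP s; rewrite representative1 vecD !add0r !unit_prod_vec.
move=> /eqP s1 /eqP ys1; 
rewrite !big_ord_recl big_ord0 !ffunE /= eqxx oner_eq0 mul1r mulr1 !mulrA => bcd.
move: s1 ys1; rewrite -!mulrA (mulrA b) bcd !mulr1 => -> .
by rewrite addvv2 => /esym/eqP; rewrite oner_eq0.
Qed.

(** Without zero entries, [secant_prod] is about [y] itself. *)
Lemma secant_weight4 y s : weight y = 4%N -> secant y s -> unit_prod y.
Proof.
move=> y4 /secant_prod ys; apply/eqP; rewrite -[RHS]ys; apply: eq_bigr => i _.
by rewrite (negbTE (weight4_neq0 i y4)).
Qed.

(** By [secant_prod] the last entry of [s] is 1, and each of the other three is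
[w] or [w ^+ 2]; their product is 1 only if they agree. *)
Lemma secant_representative3 s : secant (representative 3) s ->
  s = vec w w w 1 \/ s = vec (w ^+ 2) (w ^+ 2) (w ^+ 2) 1.
Proof.
move=> ys; have := secant_prod ys; case/andP: ys => s1 ys1.
have a0 := unit_prod_neq0 _ s1; have ya0 := unit_prod_neq0 _ ys1.
move: s1 ys1 a0 ya0; have [a [b [c [d ->]]]] := vecP s; rewrite representative3 vecD !unit_prod_vec.
rewrite !big_ord_recl big_ord0 !ffunE /= eqxx oner_eq0 !mul1r mulr1 => s1 _ a0 ya0 d1.
rewrite d1 in s1 *.
have W (x : F4) : x != 0 -> 1 + x != 0 -> x = w \/ x = w ^+ 2.
  by case: (F4P dimF4 Hw x) => ->; rewrite ?eqxx ?addvv2 ?eqxx //; [left|right].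
move: s1; rewrite mulr1.
have w22 : w ^+ 2 * w ^+ 2 = w by rewrite -exprD w4.
have w21 : w ^+ 2 * w = 1 by rewrite -exprSr.
have := a0 (inord 0); have := ya0 (inord 0); have := a0 (inord 1); have := ya0 (inord 1).
have := a0 (inord 2); have := ya0 (inord 2).
rewrite !ffunE !inordK //= => c1 c0 b1 b0 a1 {}a0 s1.
case: (W c c0 c1) (W b b0 b1) (W a a0 a1) s1 => -> [] -> [] ->;
  (try by [left|right]);
  rewrite ?w21 ?w22 -?expr2 ?mul1r -?exprS ?w3 ?mul1r ?w22 ?w21
    ?(negbTE (omega_neq1 Hw)) ?(negbTE (omega_sqr_neq1 Hw)) //.
Qed.

Lemma two_secants_representative3 : ~ two_secants (representative 3).
Proof.
case=> s [t [/secant_representative3 sE /secant_representative3 tE]].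
have D : representative 3 + vec w w w 1 = vec (w ^+ 2) (w ^+ 2) (w ^+ 2) 1.
  by rewrite representative3 vecD (addr1_omega Hw) add0r.
have D' : representative 3 + vec (w ^+ 2) (w ^+ 2) (w ^+ 2) 1 = vec w w w 1.
  by rewrite representative3 vecD (addr1_omega_sqr Hw) add0r.
by case: sE => ->; case: tE => ->; rewrite ?D ?D' ?eqxx.
Qed.

Lemma weight4_two_secants y : weight y = 4%N -> ~~ unit_prod y -> ~ two_secants y.
Proof. by move=> y4 /negP yn1 [s [t [/(secant_weight4 y4)]]]. Qed.

Lemma conjugate_two_secants y y' : conjugate y y' -> two_secants y -> two_secants y'.
Proof. by case=> h hS <-; apply: two_secants_symmetry. Qed.

(** Adding an element of full support to a vector of weight 1 leaves weight 3 or 4, and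
a vector of these weights and of product other than 1 is never on two secants. *)
Lemma joined_representative1 : ~ joined (representative 1).
Proof.
case=> s s1 [yn1 yt].
have w3y : (2 < weight (representative 1 + s)%R)%N.
  have a0 i := unit_prod_neq0 i s1; move: a0.
  have [a [b [c [d ->]]]] := vecP s; rewrite representative1 vecD weight_vec !add0r => a0.
  have := a0 (inord 1); have := a0 (inord 2); have := a0 (inord 3).
  by rewrite !ffunE !inordK //= => -> -> ->; rewrite -!addnA leq_addl.
have := w3y; have := weight_le4 (representative 1 + s); rewrite leq_eqVlt => /orP[/eqP y4 _|].
  exact: weight4_two_secants yt.
rewrite ltnS => le3 lt2; have y3 : weight (representative 1 + s) = 3%N.
  by apply/eqP; rewrite eqn_leq le3.
have y0 : representative 1 + s != 0 by rewrite -weight_gt0 y3.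
apply: two_secants_representative3.
by have := conjugate_two_secants (conjugate_representative y0) yt; rewrite /stratum (negbTE yn1) y3.
Qed.

(** The witness agrees with the representative in exactly two entries, so that the sum
has weight 2. *)
Lemma joined_representative4 : joined (representative 4).
Proof.
have w21 : w ^+ 2 * w = 1 by rewrite -exprSr.
rewrite representative4; exists (vec w 1 w w).
  by rewrite unit_prod_vec mulr1 -expr2 w21.
rewrite vecD !addvv2 (addr1_omega Hw) unit_prod_vec !mul0r eq_sym oner_eq0; split=> //.
set y := vec _ _ _ _.
have y2 : weight y = 2%N by rewrite weight_vec !eqxx w2_neq0.
have y0 : y != 0 by rewrite -weight_gt0 y2.
apply: conjugate_two_secants two_secants_representative2.
have := conjugate_sym (conjugate_representative y0); rewrite /stratum y2.
by rewrite unit_prod_vec !mul0r eq_sym oner_eq0.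
Qed.

Lemma secant_type_representative r : (0 < r <= 5)%N -> secant_type (representative r) = r.
Proof.
move=> r15; have : stratum (representative r) = r by apply: stratum_representative.
rewrite /secant_type /stratum; case: ifPn => // yn1 wr.
case: r r15 yn1 wr => [|[|[|[|[|r]]]]] // _ yn1 wr.
- have none : ~ exists s, secant (representative 1) s.
    by case=> s; apply/negP/secant_representative1.
  have no_two : ~ two_secants (representative 1).
    by case=> s [t [ys _ _ _]]; apply: none; exists s.
  by rewrite (asboolF no_two) (asboolF none) (asboolF joined_representative1).
- by rewrite (asboolT two_secants_representative2).
- have one : exists s, secant (representative 3) s.
    exists (vec w w w 1).
    rewrite /secant representative3 vecD (addr1_omega Hw) !unit_prod_vec.
    by rewrite add0r !mulr1 -expr2 -exprSr w3 -!exprD (exprM w 3 2) w3 expr1n eqxx.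
  by rewrite (asboolF two_secants_representative3) (asboolT one).
- have none : ~ exists s, secant (representative 4) s.
    by case=> s /(secant_weight4 wr); apply/negP.
  by rewrite (asboolF (weight4_two_secants wr yn1)) (asboolF none) (asboolT joined_representative4).
by have := weight_le4 (representative r.+4.+1); rewrite wr.
Qed.

Lemma stratum_secant_type y : y != 0 -> stratum y = secant_type y.
Proof.
move=> y0; have [h hS hy] := conjugate_representative y0.
by rewrite -(secant_type_symmetry y hS) hy secant_type_representative // stratum_bounds.
Qed.

Lemma conjugateP y y' : y != 0 -> y' != 0 -> conjugate y y' <-> stratum y = stratum y'.
Proof.
move=> y0 y'0; split=> [[h hS hy]|e].
  by rewrite !stratum_secant_type // -hy secant_type_symmetry.
apply: conjugate_trans (conjugate_representative y0) _; rewrite e.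
exact/conjugate_sym/conjugate_representative.
Qed.

End Model.

(** * Consequences of the universal properties *)

Section Universal.

Variable F : fieldType.

Lemma linear_add (U V : lmodType F) (f : U -> V) : linear f -> {morph f : x y / x + y}.
Proof. by move=> fL x y; rewrite -[x]scale1r fL !scale1r. Qed.

Lemma linear_zero (U V : lmodType F) (f : U -> V) : linear f -> f 0 = 0.
Proof. by move=> fL; apply: (addrI (f 0)); rewrite -linear_add // !addr0. Qed.

Lemma linear_scale (U V : lmodType F) (f : U -> V) : linear f -> forall k x, f (k *: x) = k *: f x.
Proof. by move=> fL k x; rewrite -[k *: x]addr0 fL linear_zero // addr0. Qed.

Lemma tensor_ext (V1 V2 V3 T X : lmodType F) (tau : V1 -> V2 -> V3 -> T)
    (h h' : T -> X) : is_tensor_product tau -> linear h -> linear h' ->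
  (forall a b c, h (tau a b c) = h' (tau a b c)) -> h =1 h'.
Proof.
case=> -[t1 t2 t3] univ hL h'L hh'.
have [|g [_ _ gu]] := univ X (fun a b c => h (tau a b c)).
  by split=> [b c|a c|a b] k u v; rewrite ?t1 ?t2 ?t3 hL.
by move=> x; rewrite (gu h) // (gu h').
Qed.

Lemma trilinear_ffun_prod (V1 V2 V3 : lmodType F) (A : comAlgType F) (I : finType)
    (l1 : I -> V1 -> A) (l2 : I -> V2 -> A) (l3 : I -> V3 -> A) :
    (forall i, linear (l1 i)) -> (forall i, linear (l2 i)) -> (forall i, linear (l3 i)) ->
  trilinear (fun a b c => [ffun i => l1 i a * l2 i b * l3 i c]).
Proof.
move=> L1 L2 L3; split=> [b c|a c|a b] k u v; apply/ffunP => i; rewrite !ffunE.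
- by rewrite L1 !mulrDl -!scalerAl.
- by rewrite L2 mulrDr mulrDl -scalerAr -scalerAl.
- by rewrite L3 mulrDr -scalerAr.
Qed.

Lemma base_linear_comb (K : fieldExtType F) (V : lmodType F) (X : lmodType K)
    (f : V -> X) : base_linear f ->
  forall k l u v, f (k *: u + l *: v) = k%:A *: f u + l%:A *: f v.
Proof.
move=> fL k l u v; rewrite fL; congr (_ + _).
have f0 : f 0 = 0.
  apply: (addrI (f 0)); have := fL 1 0 0.
  by rewrite /= !scale1r !addr0 => <-.
by rewrite -[l *: v]addr0 fL f0 addr0.
Qed.

Lemma scalar_extension_ext (K : fieldExtType F) (V : lmodType F) (W X : lmodType K)
    (j : V -> W) (h h' : W -> X) : is_scalar_extension j -> linear h -> linear h' ->
  (forall v, h (j v) = h' (j v)) -> h =1 h'.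
Proof.
case=> jL univ hL h'L hh'.
have [|g [_ _ gu]] := univ X (fun v => h (j v)).
  by move=> k u v; rewrite jL hL.
by move=> x; rewrite (gu h) // (gu h').
Qed.

(** The projection onto the span of the products of basis vectors fixes all pure tensors,
so it is the identity by the uniqueness part of the universal property. *)
Lemma tensor_dim_le (V1 V2 V3 T : vectType F) (tau : V1 -> V2 -> V3 -> T) :
  is_tensor_product tau -> (\dim {:T} <= \dim {:V1} * \dim {:V2} * \dim {:V3})%N.
Proof.
move=> htau; have [[t1 t2 t3] _] := htau.
pose s := [seq tau p.1.1 p.1.2 p.2 |
  p <- allpairs pair (allpairs pair (vbasis {:V1}) (vbasis {:V2})) (vbasis {:V3})].
have -> : (\dim {:V1} * \dim {:V2} * \dim {:V3})%N = size s.
  by rewrite size_map !size_allpairs !size_tuple.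
have sin a b c : a \in vbasis {:V1} -> b \in vbasis {:V2} -> c \in vbasis {:V3} ->
    tau a b c \in span s.
  move=> ia ib ic; apply: memv_span; apply/mapP; exists (a, b, c) => //.
  by apply: allpairs_f ic; apply: allpairs_f.
have closed (V : vectType F) (f : V -> T) : linear f ->
    (forall v, v \in vbasis {:V} -> f v \in span s) -> forall v, f v \in span s.
  move=> fL fs v; rewrite (coord_vbasis (memvf v)).
  elim/big_rec: _ => [|i x _ IH]; first by rewrite linear_zero ?mem0v.
  by rewrite fL memvD // memvZ // fs // memt_nth.
have full : projv (span s) =1 id.
  apply: (tensor_ext htau) => [k u v|k u v|a b c] //; first by rewrite linearP.
  apply: projv_id; apply: (closed _ (tau^~ b^~ c)) => // {}a ia.
  apply: (closed _ (fun b => tau a b c)) => // {}b ib.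
  by apply: (closed _ (tau a b)) => // {}c ic; apply: sin.
apply: leq_trans (dim_span s); apply: dimvS; apply/subvP => x _.
by rewrite -(full x) memv_proj.
Qed.

End Universal.

(** * A two-dimensional factor as the field of order four *)

Section Factor.

Variables (F4 : fieldExtType 'F_2) (w : F4).
Hypotheses (dimF4 : \dim {:F4} = 2%N) (Hw : w ^+ 2 + w + 1 = 0).
Variables (V : vectType 'F_2) (e : 'I_2 -> V).
Hypothesis he : basis_of {:V} [tuple e i | i < 2].

(** The coordinate of [1 (x) v] on [u_0]: in terms of the basis [u_0], [u_1], the vector
[e_0] is [w ^+ 2 *: u_0 + w *: u_1] and [e_1] is [u_0 + u_1]. *)
Definition factor_coord (v : V) : F4 :=
  coord [tuple e i | i < 2] 0 v *: w ^+ 2 + (coord [tuple e i | i < 2] 1 v)%:A.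

Lemma factor_coord_linear : linear factor_coord.
Proof.
move=> k u v; rewrite /factor_coord !(linearP (coord _ _)) /= !scalerDl -!scalerA.
by rewrite addrACA -scalerDr.
Qed.

Lemma factor_coord_basis k l : factor_coord (k *: e 0 + l *: e 1) = k *: w ^+ 2 + l%:A.
Proof.
have E (i : 'I_2) : e i = [tuple e i | i < 2]`_i.
  by rewrite -(tnth_nth 0 [tuple e i | i < 2] i) tnth_mktuple.
rewrite /factor_coord !linearD !linearZ /= !E !coord_free ?(basis_free he) //=.
by rewrite !mulr1 !mulr0 addr0 add0r.
Qed.

Lemma factorP v : exists k l, v = k *: e 0 + l *: e 1.
Proof.
exists (coord [tuple e i | i < 2] 0 v), (coord [tuple e i | i < 2] 1 v).
rewrite [LHS](coord_basis he (memvf v)) !big_ord_recl big_ord0 addr0.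
by rewrite -!(tnth_nth 0 [tuple e i | i < 2]) !tnth_mktuple;
  congr (coord _ _ v *: e _ + coord _ _ v *: e _); apply/val_inj.
Qed.

Lemma factor_coord_eq0 v : (factor_coord v == 0) = (v == 0).
Proof.
apply/eqP/eqP => [|->]; last by rewrite (linear_zero factor_coord_linear).
have [k [l ->]] := factorP v; rewrite factor_coord_basis.
case: (F2P k) => ->; case: (F2P l) => -> /eqP;
  rewrite ?scale0r ?scale1r ?addr0 ?add0r ?oner_eq0 ?expf_eq0 //=.
  by rewrite (negbTE (omega_neq0 Hw)).
by rewrite addrC (addr1_omega_sqr Hw) (negbTE (omega_neq0 Hw)).
Qed.

Lemma factor_coord_surj x : exists v, factor_coord v = x.
Proof.
have [a [b ->]] := F4_coordinates dimF4 Hw x; exists (b *: e 0 + (a + b) *: e 1).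
rewrite factor_coord_basis scalerDl addrCA -scalerDr.
by rewrite (addrC (w ^+ 2)) (addr1_omega_sqr Hw).
Qed.

Section Extension.

Variables (W : vectType F4) (j : V -> W).
Hypothesis hj : is_scalar_extension j.

Lemma base_linear_pow (n : nat) : base_linear (fun v => factor_coord v ^+ (2 ^ n) : F4^o).
Proof.
elim: n => [|n IH] k u v.
  by rewrite expn0 !expr1 factor_coord_linear -[k *: _]mulr_algl.
rewrite expnSr !exprM IH F4_sqrD; congr (_ + _).
rewrite [LHS]exprMn; congr (_ * _).
by case: (F2P k) => ->; rewrite /= ?scale0r ?scale1r ?expr0n ?expr1n.
Qed.

(** The coordinates with respect to [u_0] and [u_1]. On real vectors the second one is the
conjugate of the first, whence the exponent [i.+1], which is 1 or 2. *)
Lemma uvec_coordinates : exists c : 'I_2 -> W -> F4^o,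
  [/\ forall i, linear (c i), forall i v, c i (j v) = factor_coord v ^+ i.+1,
      forall i k, c i (uvec w j e k) = (i == k)%:R
    & forall z, z = c 0 z *: uvec w j e 0 + c 1 z *: uvec w j e 1].
Proof.
have [jL univ] := hj.
have /choice[c cE] (i : 'I_2) : exists c : W -> F4^o,
    linear c /\ forall v, c (j v) = factor_coord v ^+ i.+1.
  have [g [gL gj _]] := univ F4^o _ (base_linear_pow i).
  exists g; split=> // v; rewrite gj; congr (_ ^+ _).
  by move: (nat_of_ord i) (ltn_ord i) => [|[]].
have cL i : linear (c i) by case: (cE i).
have cj i v : c i (j v) = factor_coord v ^+ i.+1 by case: (cE i).
have f0 : factor_coord (e 0) = w ^+ 2.
  by have := factor_coord_basis 1 0; rewrite !scale1r !scale0r !addr0.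
have f1 : factor_coord (e 1) = 1.
  by have := factor_coord_basis 0 1; rewrite !scale1r !scale0r !add0r.
have w4 : (w ^+ 2) ^+ 2 = w by rewrite -exprM (F4_expr4 dimF4 Hw).
exists c; split=> // [i k|z].
  rewrite /uvec (linear_add (cL i)) (linear_scale (cL i)) !cj f0 f1 expr1n.
  rewrite /GRing.scale /= mulr1.
  case: i => -[|[|//]] i; case: k => -[|[|//]] k; rewrite ?expr1 ?w4 ?addvv2 //.
    by rewrite addrC (addr_omega_sqr Hw).
  by rewrite (addr_omega_sqr Hw).
symmetry; move: z; apply: (scalar_extension_ext hj) => [k u v|//|v] /=.
  by rewrite !cL !scalerDl !scalerDr !scalerA addrACA.
have [k [l ->]] := factorP v.
rewrite !cj factor_coord_basis /uvec base_linear_comb // !expr1.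
rewrite !scalerDr !scalerA addrACA -!scalerDl.
have w21 : w ^+ 2 * w = 1 by rewrite -exprSr (omega_cube Hw).
have ww : w + w ^+ 2 = 1 := addr_omega_sqr Hw.
case: (F2P k) => ->; case: (F2P l) => ->;
  rewrite ?(scale0r (w ^+ 2)) ?(scale1r (w ^+ 2)) ?scale0r ?(scale1r 1) ?addr0 ?add0r.
- by rewrite expr0n !mul0r addr0 !scale0r addr0.
- by rewrite expr1n !mul1r addvv2 ww scale0r add0r.
- by rewrite w4 w21 (mulrC w) w21 (addrC (w ^+ 2)) ww addvv2 scale0r addr0.
- by rewrite (addrC (w ^+ 2)) (addr1_omega_sqr Hw) -expr2 -exprD (F4_expr4 dimF4 Hw)
    (addrC (w ^+ 2)) ww.
Qed.

End Extension.
End Factor.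

(** * The lines of the spread *)

Lemma pointP (F : fieldType) (V : vectType F) (P : {vspace V}) :
  points P -> exists2 x, x != 0 & P = <[x]>%VS.
Proof.
move=> P1; exists (vpick P); first by rewrite vpick0 -dimv_eq0 P1.
apply/esym/eqP; rewrite eqEdim -memvE memv_pick dim_vline vpick0 -dimv_eq0.
by rewrite (P1 : \dim P = 1%N).
Qed.

Lemma vline_point (F : fieldType) (V : vectType F) (x : V) : x != 0 -> points <[x]>%VS.
Proof. by move=> x0; rewrite /points /= dim_vline x0. Qed.

Section ExtendSpan.

Variables (F : fieldType) (K : fieldExtType F) (T : vectType F) (W : vectType K).
Variables (j : T -> W) (jL : base_linear j).

Lemma base_linear0 : j 0 = 0.
Proof. by have := base_linear_comb jL 0 0 0 0; rewrite !scale0r !addr0. Qed.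

Lemma base_linear_span s x : x \in span s -> j x \in span (map j s).
Proof.
rewrite -[s]/(val (in_tuple s)) => /coord_span ->.
elim/big_rec: _ => [|i v _ IH]; first by rewrite base_linear0 mem0v.
by rewrite jL memvD // memvZ // memv_span // map_f // mem_nth.
Qed.

Lemma extend_span s : extend j (span s) = span (map j s).
Proof.
apply/eqP; rewrite eqEsubv; apply/andP; split; apply/span_subvP => _ /mapP[x xs ->].
  by apply: base_linear_span; apply: vbasis_mem.
apply: base_linear_span; rewrite (span_basis (vbasisP _)).
exact: memv_span.
Qed.

End ExtendSpan.

(** The coordinates in the extended space come in two groups [P] and [Q], those on the
tetrahedron [U] and those on its conjugate. The span of the tetrahedron
is where [Q] vanishes, and its planes are where one entry of [P] vanishes as well. *)
Section Spread.

Variables (F4 : fieldExtType 'F_2) (w : F4).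
Hypotheses (dimF4 : \dim {:F4} = 2%N) (Hw : w ^+ 2 + w + 1 = 0).
Variables (T : vectType 'F_2) (W : vectType F4) (j : T -> W).
Hypothesis jL : base_linear j.
Variable phi : T -> {ffun 'I_4 -> F4}.
Hypotheses (phiL : linear phi) (phi_eq0 : forall x, phi x = 0 -> x = 0)
  (phi_surj : forall y, exists x, phi x = y).
Variables P Q : W -> {ffun 'I_4 -> F4^o}.
Hypotheses (PL : linear P) (QL : linear Q).
Hypotheses (Pj : forall x i, P (j x) i = phi x i) (Qj : forall x i, Q (j x) i = phi x i ^+ 2).
Variable U : 'I_4 -> W.
Hypotheses (PU : forall i k, P (U i) k = (k == i)%:R) (QU : forall i, Q (U i) = 0)
  (decomposition : forall z, Q z = 0 -> z = \sum_i P z i *: U i).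
Variable B : 4.-tuple {vspace W}.
Hypothesis BU : forall i, tnth B i = <[U i]>%VS.

Let Pcomb a b u v i : P (a *: u + b *: v) i = a * P u i + b * P v i.
Proof. by rewrite (linear_add PL) !(linear_scale PL) !ffunE. Qed.

Let Qcomb a b u v i : Q (a *: u + b *: v) i = a * Q u i + b * Q v i.
Proof. by rewrite (linear_add QL) !(linear_scale QL) !ffunE. Qed.

Lemma mem_tspan z : (z \in tspan B) = (Q z == 0).
Proof.
apply/memv_sumP/eqP => [[f fB ->]|z0].
  elim/big_rec: _ => [|i v _ IH]; first exact: linear_zero.
  have := fB i isT; rewrite BU => /vlineP[k ->].
  by rewrite QL QU IH scaler0 addr0.
exists (fun i => P z i *: U i) => [i _|]; last exact: decomposition.
by rewrite BU memvZ // memv_line.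
Qed.

Lemma mem_tplane i z : (z \in tplane B i) = (Q z == 0) && (P z i == 0).
Proof.
apply/memv_sumP/andP => [[f fB ->]|[/eqP z0 /eqP zi]].
  suff [-> ->] : Q (\sum_(k < 4 | k != i) f k) = 0 /\ P (\sum_(k < 4 | k != i) f k) i = 0.
    by rewrite !eqxx.
  elim/big_rec: _ => [|k v ki [IHQ IHP]]; first by rewrite !linear_zero // ffunE.
  have := fB k ki; rewrite BU => /vlineP[c ->].
  rewrite QL QU IHQ PL !ffunE PU IHP (eq_sym i) (negbTE ki).
  by rewrite !scaler0 !addr0.
exists (fun i => P z i *: U i) => [k _|]; first by rewrite BU memvZ // memv_line.
by rewrite [LHS]decomposition // (bigD1 i) //= zi scale0r add0r.
Qed.

Lemma card_tplanes z : Q z = 0 ->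
  #|[pred i | (<[z]> <= tplane B i)%VS]| = (4 - @weight F4 (P z))%N.
Proof.
move=> z0; have := congr1 (subn^~ (@weight F4 (P z))) (cardC [pred i | P z i != 0]).
rewrite /= addKn card_ord => <-.
by apply: eq_card => i; rewrite !inE -memvE mem_tplane z0 eqxx negbK.
Qed.

Lemma weight_scale (k : F4) (y y' : {ffun 'I_4 -> F4}) : k != 0 -> (forall i, y' i = k * y i) ->
  weight y' = weight y.
Proof.
by move=> k0 e; apply: eq_card => i; rewrite !inE e mulf_eq0 (negbTE k0).
Qed.

(** Let the spread line be spanned by [j a], [j b] and meet the span of the tetrahedron in
[z = c *: j a + d *: j b]. That [Q z] vanishes means, after conjugation, that [phi b] is
a multiple of [phi a]; hence [P z] and [phi x], for each real point [x] of the line, are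
nonzero multiples of [phi a] as well. *)
Lemma weight_spread_point r x : x != 0 -> (0 < r <= 4)%N ->
  real_points_on j (spread_class j B r) <[x]>%VS -> weight (phi x) = r.
Proof.
move=> x0 /andP[r0 r4] [_ [M [[[l l2 <-] _] [X [X1 XE Xr]]]]].
have [z z0 Xz] := pointP X1; rewrite Xz in XE Xr.
have [a [b lE]] : exists a b, l = span [:: a; b] /\ free [:: a; b].
  have := span_basis (vbasisP l); have := basis_free (vbasisP l).
  case: (vbasis l) => s /= /eqP; rewrite (l2 : \dim l = 2%N).
  by case: s => [|a [|b []]] // _ fr <-; exists a, b.
case: lE => lE fr.
rewrite -[<[x]>%VS]span_seq1 lE !extend_span //= span_seq1 -memvE.
move=> /span2P[a' [b' xE]].
have zM : z \in (extend j l :&: tspan B)%VS by rewrite XE memv_line.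
move: zM; rewrite lE memv_cap mem_tspan extend_span // => /andP[/span2P[c [d zE]] /eqP Qz].
rewrite card_tplanes // in Xr.
have rel i : c ^+ 2 * phi a i + d ^+ 2 * phi b i = 0.
  have sqr (k t : F4) : (k * t ^+ 2) ^+ 2 = k ^+ 2 * t.
    by rewrite exprMn -exprM (F4_expr4 dimF4 Hw).
  have := Qcomb c d (j a) (j b) i; rewrite -zE Qz ffunE !Qj => Q0.
  by rewrite -!sqr -F4_sqrD -Q0 expr0n.
have d0 : d != 0.
  apply: contraTneq fr => d0; suff -> : a = 0 by rewrite free_cons mem0v.
  have c0 : c != 0.
    by apply: contra_neq z0 => c0; rewrite zE c0 d0 !scale0r addr0.
  apply: phi_eq0; apply/ffunP => i; have := rel i.
  rewrite d0 expr0n mul0r addr0 ffunE => /eqP; rewrite mulf_eq0 expf_eq0 /= (negbTE c0).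
  by move=> /eqP.
pose g := c ^+ 2 / d ^+ 2.
have phib i : phi b i = g * phi a i.
  apply: (mulfI (expf_neq0 2 d0)); rewrite mulrA (mulrC _ g) /g divfK ?expf_neq0 //.
  by apply/eqP; rewrite -[X in _ == X]oppv2 -addr_eq0 addrC rel.
have Pz i : P z i = (c + d * g) * phi a i by rewrite zE Pcomb !Pj phib mulrDl mulrA.
have phix i : phi x i = (a' + b' * g) * phi a i.
  by rewrite -Pj xE Pcomb !Pj phib mulrDl mulrA.
have k0 : c + d * g != 0.
  apply: contra_neq z0 => k0; rewrite [z]decomposition // big1 // => i _.
  by rewrite Pz k0 mul0r scale0r.
have l0 : a' + b' * g != 0.
  by apply: contra_neq x0 => l0; apply: phi_eq0; apply/ffunP => i; rewrite phix l0 mul0r ffunE.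
have wE : @weight F4 (P z) = weight (phi x).
  by rewrite (weight_scale k0 Pz) (weight_scale l0 phix).
move: Xr; rewrite wE => /(congr1 (subn 4)).
by rewrite !subKn // weight_le4.
Qed.

(** The line is spanned by [j x] and [j y] with [phi y] the multiple of [phi x] by [w].
Then [z = w ^+ 2 *: j x + j y] satisfies [Q z = 0] because
[w ^+ 2 + w ^+ 2 = 0], and [P z = phi x] because [w ^+ 2 + w = 1]. *)
Lemma spread_point_weight x : x != 0 ->
  real_points_on j (spread_class j B (weight (phi x))) <[x]>%VS.
Proof.
move=> x0; split; first exact: vline_point.
have [y yE] := phi_surj [ffun i => w * phi x i].
have phiy i : phi y i = w * phi x i by rewrite yE ffunE.
have [i0 xi0] : exists i, phi x i != 0.
  apply: contrapT => none; case/eqP: x0; apply: phi_eq0; apply/ffunP => i; rewrite ffunE.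
  by apply: contrapT => /eqP xi; apply: none; exists i.
have fr : free [:: x; y].
  rewrite free_cons span_seq1 seq1_free; apply/andP; split.
    apply/vlineP => -[k xE]; have : phi x i0 = (phi (k *: y)) i0 by rewrite -xE.
    case: (F2P k) => ->; rewrite (linear_scale phiL) ?scale0r ?scale1r ?ffunE.
      by move/eqP; rewrite (negbTE xi0).
    rewrite phiy -{1}[phi x i0]mul1r => /(mulIf xi0) /eqP.
    by rewrite eq_sym (negbTE (omega_neq1 Hw)).
  apply: contra_neq xi0 => y0; apply: (mulfI (omega_neq0 Hw)).
  by rewrite -phiy y0 (linear_zero phiL) ffunE mulr0.
pose z := w ^+ 2 *: j x + j y.
have Qz : Q z = 0.
  apply/ffunP => i; rewrite /z -[j y]scale1r Qcomb !Qj phiy exprMn mul1r.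
  by rewrite addvv2 ffunE.
have Pz i : P z i = phi x i.
  rewrite /z -[j y]scale1r Pcomb !Pj phiy mul1r -mulrDl addrC (addr_omega_sqr Hw).
  by rewrite mul1r.
have z0 : z != 0.
  by apply: contra_neq xi0 => z0; rewrite -Pz z0 (linear_zero PL) ffunE.
have ME : extend j (span [:: x; y]) = span [:: j x; j y] by rewrite extend_span.
have cap : (extend j (span [:: x; y]) :&: tspan B)%VS = <[z]>%VS.
  apply/vspaceP => t; rewrite memv_cap mem_tspan ME; apply/andP/vlineP.
    case=> /span2P[a [b ->]] /eqP /ffunP/(_ i0).
    rewrite Qcomb !Qj phiy exprMn [RHS]ffunE (mulrA b) -mulrDl => /eqP.
    rewrite mulf_eq0 expf_eq0 /= (negbTE xi0) orbF.
    rewrite addr_eq0 oppv2 => /eqP ->; exists b.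
    by rewrite scalerDr scalerA.
  case=> k ->; rewrite (linear_scale QL) Qz scaler0; split=> //.
  apply/span2P; exists (k * w ^+ 2), k.
  by rewrite scalerDr scalerA.
exists (extend j (span [:: x; y])); last first.
  rewrite -[<[x]>%VS]span_seq1 extend_span //= span_seq1 ME -memvE.
  by apply: memv_span; rewrite inE eqxx.
split.
  split; first by exists (span [:: x; y]) => //; apply/eqP: fr.
  by exists <[z]>%VS; [exact: vline_point | rewrite cap].
exists <[z]>%VS; split; [exact: vline_point | exact: cap|].
rewrite card_tplanes //; congr (_ - _)%N.
by apply: eq_card => i; rewrite !inE Pz.
Qed.

Lemma real_points_spread_class r : (0 < r <= 4)%N ->
  real_points_on j (spread_class j B r)
  = [set <[x]>%VS | x in [set x | x != 0 /\ weight (phi x) = r]].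
Proof.
move=> r14; apply/seteqP; split=> [S /[dup] SL [/pointP[x x0 SE] _]|_ [x [x0 <-] <-]].
  by exists x; [split=> //; apply: weight_spread_point; rewrite // -SE | rewrite SE].
exact: spread_point_weight.
Qed.

End Spread.

(** * The tensor space in four coordinates *)

Lemma linear_hom (F : fieldType) (U V : vectType F) (f : U -> V) :
  linear f -> exists g : 'Hom(U, V), g =1 f.
Proof.
move=> fL; pose f' : {linear U -> V} := HB.pack f (GRing.isLinear.Build _ _ _ _ f fL).
by exists (linfun f') => x; rewrite lfunE.
Qed.

Lemma vline2_inj (V : vectType 'F_2) (x y : V) : x != 0 -> <[x]>%VS = <[y]>%VS -> x = y.
Proof.
move=> x0 xy; have : x \in <[y]>%VS by rewrite -xy memv_line.
case/vlineP => k xE; move: x0; rewrite xE.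
by case: (F2P k) => ->; rewrite ?scale1r // scale0r eqxx.
Qed.

Section Sums.

Variables (F4 : fieldExtType 'F_2) (w : F4).
Hypotheses (dimF4 : \dim {:F4} = 2%N) (Hw : w ^+ 2 + w + 1 = 0).
Local Notation X := {ffun 'I_4 -> F4}.

(** In the first coordinate, [1 = 1 + 1 + 1], and in the others [0 = 1 + w + w ^+ 2]. The
other vectors of weight 1 follow by symmetry. *)
Lemma weight1_sum (y : X) : weight y = 1%N -> exists s1 s2 s3,
  [/\ unit_prod s1, unit_prod s2, unit_prod s3 & y = s1 + s2 + s3].
Proof.
move=> y1; have y0 : y != 0 by rewrite -weight_gt0 y1.
have := conjugate_sym (conjugate_representative dimF4 Hw y0).
rewrite /stratum y1; case: ifP => [/unit_prod_weight|_]; first by rewrite y1.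
case=> h [hL _ hU] <-.
exists (h (vec 1 1 1 1)), (h (vec 1 w w w)), (h (vec 1 (w ^+ 2) (w ^+ 2) (w ^+ 2))).
have w3 := omega_cube Hw.
rewrite !hU !unit_prod_vec !mul1r eqxx -!expr2 -!exprSr -exprM (exprM w 3 2) w3 expr1n eqxx.
split=> //; rewrite -!(linear_add hL) !vecD representative1 addvv2 add0r.
by rewrite (addr1_omega Hw) addvv2.
Qed.

Lemma unit_prod_generates (A : X -> Prop) : (forall s, unit_prod s -> A s) ->
  (forall u v, A u -> A v -> A (u + v)) -> forall y, A y.
Proof.
move=> AS AD y.
have A0 : A 0.
  have S1 : unit_prod (vec 1 1 1 1 : X) by rewrite unit_prod_vec !mulr1.
  by rewrite -(addvv2 (vec 1 1 1 1)); apply: (AD); apply: AS.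
have -> : y = \sum_k [ffun i => if i == k then y k else 0].
  apply/ffunP => i; rewrite sum_ffunE (bigD1 i) //= ffunE eqxx big1 ?addr0 // => k ki.
  by rewrite ffunE eq_sym (negbTE ki).
elim/big_rec: _ => // k v _; apply: (AD).
have [yk0|yk0] := eqVneq (y k) 0.
  have -> // : [ffun i => if i == k then y k else 0] = 0 :> X.
  by apply/ffunP => i; rewrite !ffunE yk0 if_same.
have [|s1 [s2 [s3 [S1 S2 S3 ->]]]] := @weight1_sum [ffun i => if i == k then y k else 0].
  rewrite -[RHS](card1 k); apply: eq_card => i; rewrite !inE ffunE.
  by case: ifP; rewrite ?yk0 ?eqxx.
by apply: (AD); [apply: (AD)|]; apply: AS.
Qed.

End Sums.

(** The index triples 000, 011, 101, 110 of the vertices of the tetrahedron, listed by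
factor: [even_index k i] is the [k]-th entry of the [i]-th triple. *)
Definition even_index : 'I_3 -> 'I_4 -> 'I_2 := fun k i =>
  nth 0 (nth [::] [:: [:: 0; 0; 1; 1]; [:: 0; 1; 0; 1]; [:: 0; 1; 1; 0]] k) i.

Section Assembly.

Variables (V1 V2 V3 T : vectType 'F_2).
Hypotheses (dimV1 : \dim {:V1} = 2%N) (dimV2 : \dim {:V2} = 2%N) (dimV3 : \dim {:V3} = 2%N).
Variables (tau : V1 -> V2 -> V3 -> T).
Hypothesis (htau : is_tensor_product tau).
Variables (F4 : fieldExtType 'F_2) (w : F4).
Hypotheses (dimF4 : \dim {:F4} = 2%N) (Hw : w ^+ 2 + w + 1 = 0).
Variables (e1 : 'I_2 -> V1) (e2 : 'I_2 -> V2) (e3 : 'I_2 -> V3).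
Hypotheses (he1 : basis_of {:V1} [tuple e1 i | i < 2])
  (he2 : basis_of {:V2} [tuple e2 i | i < 2]) (he3 : basis_of {:V3} [tuple e3 i | i < 2]).

Local Notation X := {ffun 'I_4 -> F4}.
Local Notation lam1 := (factor_coord w e1).
Local Notation lam2 := (factor_coord w e2).
Local Notation lam3 := (factor_coord w e3).

Definition tensor_coord (phi : T -> X) := linear phi /\
  forall a b c, phi (tau a b c) = [ffun i =>
    lam1 a ^+ (even_index 0 i).+1 * lam2 b ^+ (even_index 1 i).+1 * lam3 c ^+ (even_index 2 i).+1].

Lemma tensor_coord_vec phi : tensor_coord phi -> forall a b c, phi (tau a b c) =
   vec (lam1 a * lam2 b * lam3 c) (lam1 a * lam2 b ^+ 2 * lam3 c ^+ 2)
       (lam1 a ^+ 2 * lam2 b * lam3 c ^+ 2) (lam1 a ^+ 2 * lam2 b ^+ 2 * lam3 c).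
Proof.
case=> _ phiE a b c; rewrite phiE; apply/ffunP => -[[|[|[|[|//]]]] i]; by rewrite !ffunE /= ?expr1.
Qed.

Lemma factor_coord_pow_linear (V : vectType 'F_2) (e : 'I_2 -> V) (i : 'I_2) :
  linear (fun v => factor_coord w e v ^+ i.+1).
Proof.
apply: additive_linear2 => u v; rewrite (linear_add (factor_coord_linear w e)).
by case: i => -[|[|//]] i; rewrite ?expr1 // F4_sqrD.
Qed.

Lemma tensor_coord_exists : exists phi, tensor_coord phi.
Proof.
have [_ univ] := htau.
have [|phi [phiL phiE _]] := univ X (fun a b c => [ffun i =>
    lam1 a ^+ (even_index 0 i).+1 * lam2 b ^+ (even_index 1 i).+1 * lam3 c ^+ (even_index 2 i).+1]).
  by apply: trilinear_ffun_prod => i; apply: factor_coord_pow_linear.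
by exists phi; split.
Qed.

Variable phi : T -> X.
Hypothesis phiP : tensor_coord phi.
Let phiL : linear phi. Proof. by case: phiP. Qed.

Lemma tensor_coord_unit a b c : a != 0 -> b != 0 -> c != 0 -> unit_prod (phi (tau a b c)).
Proof.
move=> a0 b0 c0; rewrite (tensor_coord_vec phiP) unit_prod_vec.
have cube (V : vectType 'F_2) (e : 'I_2 -> V) (v : V) :
    basis_of {:V} [tuple e i | i < 2] -> v != 0 ->
    factor_coord w e v ^+ 3 = 1.
  by move=> he v0; rewrite (F4_cube dimF4 Hw) // (factor_coord_eq0 Hw he).
set x := lam1 a; set y := lam2 b; set z := lam3 c.
rewrite (_ : _ * _ = (x ^+ 3) ^+ 2 * (y ^+ 3) ^+ 2 * (z ^+ 3) ^+ 2); last by ring.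
by rewrite !cube // !expr1n !mulr1.
Qed.

(** If the entries [p], [q], [r], [s] come from the coordinates [x], [y], [z] of the three
factors, then [p * q = x ^+ 2 * (y * z) ^+ 3 = x ^+ 2], hence [x = (p * q) ^+ 2]; the
other two are found in the same way. *)
Lemma unit_tensor y : unit_prod y ->
  exists a b c, [/\ a != 0, b != 0, c != 0 & phi (tau a b c) = y].
Proof.
move=> y1; have [p [q [r [s yE]]]] := vecP y.
have [a aE] := factor_coord_surj dimF4 Hw he1 ((p * q) ^+ 2).
have [b bE] := factor_coord_surj dimF4 Hw he2 ((p * r) ^+ 2).
have [c cE] := factor_coord_surj dimF4 Hw he3 ((p * s) ^+ 2).
exists a, b, c.
rewrite -(factor_coord_eq0 Hw he1) -(factor_coord_eq0 Hw he2) -(factor_coord_eq0 Hw he3).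
rewrite (tensor_coord_vec phiP) aE bE cE.
have nz i := unit_prod_neq0 i y1.
move: y1 nz; rewrite yE unit_prod_vec => /eqP y1 nz.
have := nz (inord 0); have := nz (inord 1); have := nz (inord 2); have := nz (inord 3).
rewrite !ffunE !inordK //= => s0 r0 q0 p0.
split; rewrite ?expf_eq0 ?mulf_eq0 ?(negbTE p0) ?(negbTE q0) ?(negbTE r0) ?(negbTE s0) //.
have C x x0 := @F4_cube _ _ dimF4 Hw x x0.
congr vec.
- transitivity ((p * q * r * s) ^+ 2 * p ^+ 4); first by ring.
  by rewrite y1 expr1n mul1r (F4_expr4 dimF4 Hw).
- rewrite -[LHS]mulr1 -(C q q0).
  transitivity ((p * q * r * s) ^+ 4 * (p ^+ 3) ^+ 2 * q); first by ring.
  by rewrite y1 C // !expr1n !mul1r.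
- rewrite -[LHS]mulr1 -(C r r0).
  transitivity ((p * q * r * s) ^+ 4 * (p ^+ 3) ^+ 2 * r); first by ring.
  by rewrite y1 C // !expr1n !mul1r.
rewrite -[LHS]mulr1 -(C s s0).
transitivity ((p * q * r * s) ^+ 4 * (p ^+ 3) ^+ 2 * s); first by ring.
by rewrite y1 C // !expr1n !mul1r.
Qed.

Lemma tensor_coord_surj y : exists x, phi x = y.
Proof.
move: y; apply: (unit_prod_generates dimF4 Hw) => [s|u v [x <-] [x' <-]].
  by case/unit_tensor=> a [b [c [_ _ _ <-]]]; exists (tau a b c).
by exists (x + x'); rewrite (linear_add phiL).
Qed.

(** The map is onto a space of dimension 8, and its domain has dimension at most 8. *)
Lemma tensor_coord_eq0 x : phi x = 0 -> x = 0.
Proof.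
have [f fE] := linear_hom phiL; rewrite -fE => fx0.
have full : limg f = fullv.
  apply/vspaceP => y; rewrite memvf; apply/memv_imgP.
  by have [t tE] := tensor_coord_surj y; exists t; rewrite ?memvf // fE.
have dimX : \dim {: X} = 8%N.
  by rewrite dimvf /dim /= card_ord -dimvf dimF4.
have := tensor_dim_le htau; rewrite dimV1 dimV2 dimV3 -(limg_ker_dim f fullv) full dimX.
rewrite -[X in (_ <= X)%N]add0n leq_add2r leqn0 dimv_eq0 capfv => /eqP ker0.
by apply/eqP; rewrite -memv0 -ker0 memv_ker fx0.
Qed.

Let phi_inj : injective phi.
Proof.
move=> x y e; apply/eqP; rewrite -[y]oppv2 -addr_eq0; apply/eqP/tensor_coord_eq0.
by rewrite (linear_add phiL) e addvv2.
Qed.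

Lemma Segre_vline x : x != 0 -> Segre tau <[x]>%VS <-> unit_prod (phi x).
Proof.
move=> x0; split=> [[a [b [c [a0 b0 c0 /(vline2_inj x0) ->]]]]|].
  exact: tensor_coord_unit.
by case/unit_tensor=> a [b [c [a0 b0 c0 e]]]; exists a, b, c; split=> //; rewrite (phi_inj e).
Qed.

Lemma Segre_point R : Segre tau R -> exists2 x, x != 0 & R = <[x]>%VS.
Proof.
case=> a [b [c [a0 b0 c0 ->]]]; exists (tau a b c) => //.
apply: contraTneq (tensor_coord_unit a0 b0 c0) => ->; rewrite (linear_zero phiL).
by apply/negP => /unit_prod_neq0 - /(_ 0); rewrite ffunE eqxx.
Qed.

(** Over the field with two elements, points are nonzero vectors and projectivities are
linear bijections, which [phi] transports to the coordinate space. *)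
Lemma stabiliser_conjugate x x' : x != 0 -> x' != 0 ->
  (exists2 g, stabiliser (Segre tau) g & g <[x]>%VS = <[x']>%VS) <-> conjugate (phi x) (phi x').
Proof.
have /choice[psi phiK] := tensor_coord_surj.
have psiK : cancel phi psi by move=> t; apply: phi_inj; rewrite phiK.
have phi0 t : (phi t == 0) = (t == 0).
  by rewrite -(inj_eq phi_inj) (linear_zero phiL).
move=> x0 x'0; split=> [[g [[f f0 gE] gS] gx]|[h hS hx]].
  have finj : injective f by apply/lker0P/eqP.
  exists (phi \o f \o psi); last first.
    rewrite /= psiK; congr phi; apply: (vline2_inj (V := T)); last by rewrite -gx gE limg_line.
    by rewrite -(linear0 f) (inj_eq finj).
  split=> [k u v|| y].
  - rewrite /= -phiL -linearP; congr (phi (f _)); apply: phi_inj.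
    by rewrite phiL !phiK.
  - exists (phi \o (f^-1)%VF \o psi) => y /=.
      by rewrite psiK lker0_lfunK ?phiK //; apply/eqP.
    by rewrite psiK lker0_lfunVK ?phiK //; apply/eqP.
  have [->|y0] := eqVneq y 0.
    rewrite /= (_ : psi 0 = 0) ?linear0 ?(linear_zero phiL) //.
    by apply: phi_inj; rewrite phiK linear_zero.
  rewrite /= -{2}(phiK y); have {y0} : psi y != 0 by rewrite -phi0 phiK.
  move: (psi y) => t t0.
  have ft0 : f t != 0 by rewrite -(linear0 f) (inj_eq finj).
  have Sf t' : Segre tau t' -> Segre tau (f @: t')%VS.
    by move=> St'; rewrite -gS; exists t'; rewrite ?gE.
  apply/idP/idP => [/Segre_vline - /(_ ft0)|/Segre_vline - /(_ t0) /Sf]; last first.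
    by rewrite limg_line => /Segre_vline; apply.
  rewrite -{1}gS => -[t' St'].
  have := St'; case=> a [b [c [a0 b0 c0 t'E]]].
  rewrite gE t'E limg_line => e; suff -> : t = tau a b c by apply: tensor_coord_unit.
  apply: finj; apply: (vline2_inj ft0); exact: esym.
have [hL _ hU] := hS.
have [|f fE] := @linear_hom _ _ _ (psi \o h \o phi).
  by move=> k u v /=; rewrite phiL hL; apply: phi_inj; rewrite phiL !phiK.
have phif t : phi (f t) = h (phi t) by rewrite fE /= phiK.
have finj : injective f.
  move=> u v /(congr1 phi); rewrite !phif => e; apply: phi_inj.
  by case: hS => _ /bij_inj hinj _; apply: hinj.
have f0 t : (f t == 0) = (t == 0) by rewrite -{1}(linear0 f) (inj_eq finj).
exists (fun t => f @: t)%VS; last first.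
  by rewrite limg_line; congr <[_]>%VS; apply: phi_inj; rewrite phif.
split; first by exists f => //; apply/eqP/lker0P.
have [h' h'S hK'] := symmetry_inv hS; have [_ _ h'U] := h'S.
apply/seteqP; split=> [_ [R RS <-]|R RS]; have [v v0 RE] := Segre_point RS; move: RS;
  rewrite RE => /Segre_vline - /(_ v0) Uv.
  by rewrite limg_line; apply/Segre_vline; rewrite ?f0 // phif hU.
have vE : f (psi (h' (phi v))) = v.
  by apply: phi_inj; rewrite phif phiK; case: h'S => _ /bij_inj h'inj _; apply: h'inj; rewrite hK'.
exists <[psi (h' (phi v))]>%VS; last by rewrite limg_line vE.
apply/Segre_vline; last by rewrite phiK h'U.
by rewrite -f0 vE.
Qed.

End Assembly.

(** The eight terms are grouped by parity of the index triple, because complementation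
exchanges the tetrahedron with its conjugate. *)
Lemma trilinear_expand (F : fieldType) (V1 V2 V3 X : lmodType F) (f : V1 -> V2 -> V3 -> X)
    (x1 x2 x3 : 'I_2 -> F) (u1 : 'I_2 -> V1) (u2 : 'I_2 -> V2) (u3 : 'I_2 -> V3) :
  trilinear f ->
  f (x1 0 *: u1 0 + x1 1 *: u1 1) (x2 0 *: u2 0 + x2 1 *: u2 1) (x3 0 *: u3 0 + x3 1 *: u3 1)
  = \sum_(i < 4) (x1 (even_index 0 i) * x2 (even_index 1 i) * x3 (even_index 2 i))
      *: f (u1 (even_index 0 i)) (u2 (even_index 1 i)) (u3 (even_index 2 i))
  + \sum_(i < 4) (x1 (rev_ord (even_index 0 i)) * x2 (rev_ord (even_index 1 i))
                    * x3 (rev_ord (even_index 2 i)))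
      *: f (u1 (rev_ord (even_index 0 i))) (u2 (rev_ord (even_index 1 i)))
           (u3 (rev_ord (even_index 2 i))).
Proof.
case=> t1 t2 t3.
have r0 : rev_ord (0 : 'I_2) = 1 by apply/val_inj.
have r1 : rev_ord (1 : 'I_2) = 0 by apply/val_inj.
rewrite !big_ord_recl !big_ord0 !addr0 /even_index /= !r0 !r1.
rewrite (linear_add (t1 _ _)) !(linear_scale (t1 _ _)).
rewrite !(linear_add (t2 _ _)) !(linear_scale (t2 _ _)).
rewrite !(linear_add (t3 _ _)) !(linear_scale (t3 _ _)).
rewrite !scalerDr !scalerA !addrA.
by rewrite [LHS](ACl (1*4*6*7*8*5*3*2)%AC).
Qed.

(** * Coordinates in the extended tensor space *)

Section Frame.

Variables (V1 V2 V3 T : vectType 'F_2).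
Variables (tau : V1 -> V2 -> V3 -> T).
Hypothesis (htau : is_tensor_product tau).
Variables (F4 : fieldExtType 'F_2) (w : F4).
Hypotheses (dimF4 : \dim {:F4} = 2%N) (Hw : w ^+ 2 + w + 1 = 0).
Variables (W1 W2 W3 W : vectType F4).
Variables (j1 : V1 -> W1) (j2 : V2 -> W2) (j3 : V3 -> W3).
Hypotheses (hj1 : is_scalar_extension j1) (hj2 : is_scalar_extension j2)
  (hj3 : is_scalar_extension j3).
Variable (tauW : W1 -> W2 -> W3 -> W).
Hypothesis (htauW : is_tensor_product tauW).
Variable (j : T -> W).
Hypothesis (hj : is_real_inclusion tau tauW j1 j2 j3 j).
Variables (e1 : 'I_2 -> V1) (e2 : 'I_2 -> V2) (e3 : 'I_2 -> V3).
Hypotheses (he1 : basis_of {:V1} [tuple e1 i | i < 2])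
  (he2 : basis_of {:V2} [tuple e2 i | i < 2]) (he3 : basis_of {:V3} [tuple e3 i | i < 2]).
Variable phi : T -> {ffun 'I_4 -> F4}.
Hypothesis phiP : tensor_coord tau w e1 e2 e3 phi.

Definition frame_vector (i : 'I_4) : W :=
  tauW (uvec w j1 e1 (even_index 0 i)) (uvec w j2 e2 (even_index 1 i))
    (uvec w j3 e3 (even_index 2 i)).

Lemma tnth_Bplus i :
  tnth (Bplus tauW (uvec w j1 e1) (uvec w j2 e2) (uvec w j3 e3)) i = <[frame_vector i]>%VS.
Proof. by rewrite tnth_map; case: i => -[|[|[|[|//]]]] i. Qed.

Lemma frame_coordinates : exists P Q : W -> {ffun 'I_4 -> F4^o},
  [/\ linear P, linear Q, forall x i, P (j x) i = phi x i, forall x i, Q (j x) i = phi x i ^+ 2 &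
   [/\ forall i k, P (frame_vector i) k = (k == i)%:R, forall i, Q (frame_vector i) = 0
   & forall z, Q z = 0 -> z = \sum_i P z i *: frame_vector i]].
Proof.
have [c1 [c1L c1j c1u c1E]] := uvec_coordinates dimF4 Hw he1 hj1.
have [c2 [c2L c2j c2u c2E]] := uvec_coordinates dimF4 Hw he2 hj2.
have [c3 [c3L c3j c3u c3E]] := uvec_coordinates dimF4 Hw he3 hj3.
have [tW univ] := htauW; have [jL jt] := hj; have [phiL phit] := phiP.
have [P [PL PE _]] := univ _ _ (trilinear_ffun_prod
  (fun i => c1L (even_index 0 i)) (fun i => c2L (even_index 1 i)) (fun i => c3L (even_index 2 i))).
have [Q [QL QE _]] := univ _ _ (trilinear_ffun_prod
  (fun i => c1L (rev_ord (even_index 0 i))) (fun i => c2L (rev_ord (even_index 1 i)))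
  (fun i => c3L (rev_ord (even_index 2 i)))).
have jD : {morph j : x y / x + y}.
  by move=> x y; have := base_linear_comb jL 1 1 x y; rewrite !scale1r.
exists P, Q; split=> //.
- have PjL : linear (fun x => P (j x) : {ffun 'I_4 -> F4}).
    by apply: additive_linear2 => x y; rewrite jD (linear_add PL).
  move=> x i; suff -> : P (j x) = phi x by [].
  move: x; apply: (tensor_ext htau) => // a b c.
  by rewrite jt PE phit; apply/ffunP => k; rewrite !ffunE c1j c2j c3j.
- pose q x : {ffun 'I_4 -> F4} := [ffun i => phi x i ^+ 2].
  have qL : linear q.
    apply: additive_linear2 => x y; apply/ffunP => k.
    by rewrite !ffunE (linear_add phiL) ffunE F4_sqrD.
  have QjL : linear (fun x => Q (j x) : {ffun 'I_4 -> F4}).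
    by apply: additive_linear2 => x y; rewrite jD (linear_add QL).
  have E (t : F4) (k : 'I_2) : t ^+ (rev_ord k).+1 = (t ^+ k.+1) ^+ 2.
    by rewrite -exprM; case: k => -[|[|//]] k //=; rewrite (F4_expr4 dimF4 Hw).
  move=> x i; suff -> : Q (j x) = q x by rewrite ffunE.
  move: x; apply: (tensor_ext htau) => // a b c.
  by rewrite jt QE; apply/ffunP => k; rewrite !ffunE phit ffunE c1j c2j c3j !E -!exprMn.
split.
- move=> i k; rewrite PE ffunE c1u c2u c3u.
  case: i => -[|[|[|[|//]]]] i; case: k => -[|[|[|[|//]]]] k;
  by rewrite /= ?mulr1 ?mul1r ?mulr0 ?mul0r.
- move=> i; rewrite QE; apply/ffunP => k; rewrite !ffunE c1u c2u c3u.
  case: i => -[|[|[|[|//]]]] i; case: k => -[|[|[|[|//]]]] k;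
  by rewrite /= ?mulr1 ?mul1r ?mulr0 ?mul0r.
move=> z Qz.
pose conj_vector i := tauW (uvec w j1 e1 (rev_ord (even_index 0 i)))
  (uvec w j2 e2 (rev_ord (even_index 1 i))) (uvec w j3 e3 (rev_ord (even_index 2 i))).
have combL (R : W -> {ffun 'I_4 -> F4^o}) (v : 'I_4 -> W) : linear R ->
    linear (fun z => \sum_i R z i *: v i).
  move=> RL k x y; rewrite scaler_sumr -big_split; apply: eq_bigr => i _.
  by rewrite RL !ffunE scalerDl scalerA.
have dec : (fun z => \sum_i P z i *: frame_vector i + \sum_i Q z i *: conj_vector i) =1 id.
  apply: (tensor_ext htauW) => [k u v|//|a b c].
    by rewrite (combL P) // (combL Q) // addrACA -scalerDr.
  have := trilinear_expand (c1^~ a) (c2^~ b) (c3^~ c)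
    (uvec w j1 e1) (uvec w j2 e2) (uvec w j3 e3) tW.
  rewrite -c1E -c2E -c3E PE QE => ->.
  by congr (_ + _); apply: eq_bigr => i _; rewrite !ffunE.
rewrite -[LHS]dec Qz [X in _ + X]big1 ?addr0 // => i _.
by rewrite ffunE scale0r.
Qed.

End Frame.

(** * The orbits of the stabiliser *)

Theorem proposition5
    (V1 V2 V3 T : vectType 'F_2)
    (dimV1 : \dim {:V1} = 2%N) (dimV2 : \dim {:V2} = 2%N) (dimV3 : \dim {:V3} = 2%N)
    (tau : V1 -> V2 -> V3 -> T) (htau : is_tensor_product tau)
    (F4 : fieldExtType 'F_2) (dimF4 : \dim {:F4} = 2%N)
    (omega : F4) (homega : omega ^+ 2 + omega + 1 = 0)
    (W1 W2 W3 W : vectType F4)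
    (j1 : V1 -> W1) (hj1 : is_scalar_extension j1)
    (j2 : V2 -> W2) (hj2 : is_scalar_extension j2)
    (j3 : V3 -> W3) (hj3 : is_scalar_extension j3)
    (tauW : W1 -> W2 -> W3 -> W) (htauW : is_tensor_product tauW)
    (j : T -> W) (hj : is_real_inclusion tau tauW j1 j2 j3 j)
    (e1 : 'I_2 -> V1) (he1 : basis_of {:V1} [tuple e1 i | i < 2])
    (e2 : 'I_2 -> V2) (he2 : basis_of {:V2} [tuple e2 i | i < 2])
    (e3 : 'I_2 -> V3) (he3 : basis_of {:V3} [tuple e3 i | i < 2]) :
  let S := Segre tau in
  let B := Bplus tauW (uvec omega j1 e1) (uvec omega j2 e2) (uvec omega j3 e3) in
  let L := spread_class j B in
  exists O : nat -> set {vspace T},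
    [/\ (forall r s : nat, (0 < r <= 5)%N -> (0 < s <= 5)%N ->
           O r = O s -> r = s),
        point_orbits (stabiliser S) = [set O r | r in [set r : nat | (0 < r <= 5)%N]],
        (forall r : nat, (0 < r <= 3)%N -> O r = real_points_on j (L r)),
        O 4%N = real_points_on j (L 4%N) `\` S
      & O 5%N = S].
Proof.
move=> S B L.
have [phi phiP] := tensor_coord_exists htau omega e1 e2 e3.
have [phiL _] := phiP.
have surj := tensor_coord_surj dimF4 homega he1 he2 he3 phiP.
have eq0 := tensor_coord_eq0 dimV1 dimV2 dimV3 htau dimF4 homega he1 he2 he3 phiP.
have SP := Segre_vline dimV1 dimV2 dimV3 htau dimF4 homega he1 he2 he3 phiP.
have orbitP := stabiliser_conjugate dimV1 dimV2 dimV3 htau dimF4 homega he1 he2 he3 phiP.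
have phi0 x : x != 0 -> phi x != 0 by apply: contra_neq => /eq0.
have [P [Q [PL QL Pj Qj [PU QU dec]]]] :=
  frame_coordinates htau dimF4 homega hj1 hj2 hj3 htauW hj he1 he2 he3 phiP.
have classP r : (0 < r <= 4)%N -> real_points_on j (L r) =
    [set <[x]>%VS | x in [set x | x != 0 /\ weight (phi x) = r]].
  apply: (real_points_spread_class dimF4 homega _ phiL eq0 surj PL QL Pj Qj PU QU dec
    (tnth_Bplus _ _ _ _ _ _ _ _)).
  by case: hj.
pose O r := [set <[x]>%VS | x in [set x | x != 0 /\ stratum (phi x) = r]].
have inO r x : x != 0 -> O r <[x]>%VS <-> stratum (phi x) = r.
  move=> x0; split=> [[y [y0 <-] /(vline2_inj y0) ->] //|xr].
  by exists x.
have nonempty r : (0 < r <= 5)%N -> exists2 x, x != 0 & stratum (phi x) = r.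
  move=> r15; have [x xE] := surj (representative omega r).
  have sr := stratum_representative homega r15.
  exists x; last by rewrite xE.
  apply: contraTneq r15 => x0; rewrite -sr -xE x0 (linear_zero phiL) /stratum.
  rewrite ifF; first by rewrite lt0n -leqn0 leqNgt weight_gt0 eqxx.
  by apply/negP => /unit_prod_neq0 - /(_ 0); rewrite ffunE eqxx.
exists O; split.
- move=> r s r15 _ rs; have [x x0 xr] := nonempty r r15.
  have : O r <[x]>%VS by apply/inO.
  by rewrite rs => /(inO _ _ x0); rewrite xr.
- have orbitE x : x != 0 -> [set g <[x]>%VS | g in stabiliser S] = O (stratum (phi x)).
    move=> x0; apply/seteqP; split=> [_ [g gS <-]|_ [y [y0 yx] <-]].
      have [f f0 gE] : PGL g by case: gS.
      have finj : injective f by apply/lker0P/eqP.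
      have fx0 : f x != 0 by rewrite -(linear0 f) (inj_eq finj).
      rewrite gE limg_line; apply/inO => //; apply/esym.
      apply/(conjugateP dimF4 homega); rewrite ?phi0 //.
      by apply/orbitP => //; exists g; rewrite // gE limg_line.
    have /(orbitP _ _ x0 y0)[g gS gE] : conjugate (phi x) (phi y).
      by apply/(conjugateP dimF4 homega); rewrite ?phi0.
    by exists g.
  apply/seteqP; split=> [_ [R /pointP[x x0 ->] <-]|_ [r r15 <-]].
    by rewrite orbitE //; exists (stratum (phi x)) => //; apply: stratum_bounds; apply: phi0.
  have [x x0 xr] := nonempty r r15.
  by exists <[x]>%VS; [apply: vline_point | rewrite orbitE // xr].
- move=> r /andP[r0 r3]; rewrite classP ?r0 ?(leq_trans r3) //.
  congr (image _ _); apply/seteqP; split=> x [x0 xr]; split=> //; move: xr; rewrite /stratum.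
    by case: ifP => // _ r5; rewrite -r5 in r3.
  by case: ifP => // /unit_prod_weight -> r4; rewrite -r4 in r3.
- rewrite classP //; apply/seteqP; split=> [_ [x [x0 x4] <-]|_ [[x [x0 x4] <-] xS]].
    have nS : ~~ unit_prod (phi x) by rewrite -stratum_eq5 x4.
    split; last by move/SP => /(_ x0); apply/negP.
    by exists x => //; split=> //; move: x4; rewrite /stratum (negbTE nS).
  apply/inO => //; rewrite /stratum; case: ifP => // xU.
  by case: xS; apply/SP.
apply/seteqP; split=> [_ [x [x0 x5] <-]|R].
  by apply/SP => //; rewrite -stratum_eq5 x5.
move=> RS; have [x x0 RE] := Segre_point dimF4 homega he1 he2 he3 phiP RS.
rewrite RE; apply/inO => //; apply/eqP; rewrite stratum_eq5; apply/SP => //.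
by rewrite -RE.
Qed.
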